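(* Let $\kappa\ge1$ and $V\in\mathcal{P}_1(\kappa)$. (i) There is a constant $c(\kappa)>0$, depending only on $\kappa$, such that for every integer $n\ge1$ and every $x\in\mathbb{R}$ with $V(x)\ge4E_n(V)$, $$\psi_n(x;V)^2+\frac{\psi_n'(x;V)^2}{E_n(V)}\lesssim_\kappa\frac{1}{|\{V\le E_n(V)\}|}\,e^{-c(\kappa)|x|\sqrt{V(x)}}.$$ (ii) If a (measurable) function $W:\mathbb{R}\to[0,\infty)$, $a,b\in\mathbb{R}$ and $C>0$ are such that $$W(x)\le C|x|^aV(x)^b\quad\text{and}\quad\int_{-|x|}^{|x|}W(t)\,dt\le C|x|^{a+1}V(x)^b\qquad\text{for all }x\in\mathbb{R}\setminus\{0\},\qquad(\ast)$$ then, for every integer $n\ge1$, $$\int_\mathbb{R}W(x)\left(\psi_n(x;V)^2+\frac{\psi_n'(x;V)^2}{E_n(V)}\right)dx\lesssim_{a,b,\kappa}C\,|\{V\le E_n(V)\}|^a\,E_n(V)^b.$$ (iii) The assumption $(\ast)$ holds whenever $W(x)=|x|^aV(x)^b$ and $a+\kappa^{-1}b>-1$, with a constant $C=C(a,b,\kappa)$ depending only on $a,b,\kappa$.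
   Context: For $\kappa\ge1$, $\mathcal{P}_1(\kappa)$ is the class of functions $V:\mathbb{R}\to[0,\infty)$ such that: $V(0)=0$; $V(-x)\le\kappa V(x)$ for all $x\in\mathbb{R}$; and both functions $x\mapsto V(x)$ and $x\mapsto V(-x)$, restricted to $\mathbb{R}^+=(0,\infty)$, are positive, of class $C^1(\mathbb{R}^+)$ and satisfy $\kappa^{-1}U(x)\le xU'(x)\le\kappa U(x)$ for all $x>0$ (with $U$ the function in question). For such $V$, the Schrödinger operator $\mathcal{H}[V]=-\partial_x^2+V(x)$ on $L^2(\mathbb{R})$, initially defined on $C_c^\infty(\mathbb{R})$, is essentially self-adjoint, with pure point spectrum consisting of a divergent sequence of simple eigenvalues $E_1(V)<E_2(V)<\cdots$. The corresponding real-valued eigenfunctions $\psi_n(\cdot;V)$ are normalised by $\int_\mathbb{R}\psi_n(x;V)^2\,dx=1$ and $\psi_n(x;V)>0$ for all sufficiently large $x>0$; $\psi_n'$ is the $x$-derivative. $|A|$ is the Lebesgue measure of $A$ and $\{V\le E\}=\{x\in\mathbb{R}:V(x)\le E\}$. $A\lesssim_aB$ means $A\le KB$ with $K$ depending only on the indicated parameters.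
   Formalization: Part (iii) also assumes a+κb>-1, automatic for b≥0; for b<0 the claim as printed fails (V=x², κ=2, a=0, b=-1: W=x⁻² is not integrable at 0), and V=|x|^κ shows the condition is necessary. In (ii) measurable means Borel. *)

(* Defs.v *)
From mathcomp Require Import all_boot all_order all_algebra.
From mathcomp Require Import all_classical all_reals all_analysis.
Import Order.TTheory GRing.Theory Num.Theory.
Import numFieldNormedType.Exports.

Set Implicit Arguments.
Unset Strict Implicit.
Unset Printing Implicit Defensive.

Local Open Scope classical_set_scope.
Local Open Scope ring_scope.

Section Potentials.
Context {R : realType}.
Implicit Types (kappa : R) (U V : R -> R).

Definition power_like kappa U : Prop := forall x : R, 0 < x ->
  [/\ 0 < U x, derivable U x 1, {for x, continuous (derive1 U)} &
      kappa^-1 * U x <= x * derive1 U x <= kappa * U x].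

Definition potential_class kappa V : Prop :=
  [/\ (forall x, 0 <= V x), V 0 = 0, (forall x, V (- x) <= kappa * V x),
      power_like kappa V & power_like kappa (fun x => V (- x))].

Definition sublevel_length V (E : R) : R :=
  fine (@lebesgue_measure R [set x | V x <= E]).

End Potentials.

Section SchrodingerOperator.
Context {R : realType}.
Implicit Types (V phi psi u v : R -> R) (E : R) (n : nat).

Local Notation mu := (@lebesgue_measure R).

Definition test_function phi : Prop :=
  (forall (k : nat) (x : R), derivable (derive1n k phi) x 1) /\
  compact (closure [set x | phi x != 0]).

(* Elements of L^2 are represented by functions, and the L^2 distance does not
   see null sets. Only real-valued functions are needed: the operator commutes
   with complex conjugation and its eigenvalues are real, so it has the same
   eigenvalues, with the same multiplicities, on real and on complex L^2. *)
Definition L2_cvg (u_ : nat -> R -> R) u : Prop :=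
  Lnorm mu 2%:E (EFin \o (u_ k \- u)) @[k --> \oo] --> 0%E.

(* [schrodinger V u v] means that u lies in the domain of H[V] and H[V] u = v,
   where H[V] is the L^2 closure of - d^2/dx^2 + V on test functions, i.e. its
   unique self-adjoint extension when that operator is essentially
   self-adjoint. *)
Definition schrodinger V u v : Prop :=
  [/\ u \in Lfun mu 2%:E, v \in Lfun mu 2%:E &
      exists phi_ : nat -> R -> R,
        [/\ forall k, test_function (phi_ k), L2_cvg phi_ u &
            L2_cvg (fun k x => - derive1n 2 (phi_ k) x + V x * phi_ k x) v]].

Definition schrodinger_eigenvalue V E : Prop :=
  exists2 u : R -> R, Lnorm mu 2%:E (EFin \o u) != 0%E &
                      schrodinger V u (fun x => E * u x).

(* Eigenvalues are numbered from n = 1. As they are simple, counting them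
   without multiplicity is the same as counting them with multiplicity. *)
Definition nth_eigenvalue V n E : Prop :=
  [/\ (0 < n)%N, schrodinger_eigenvalue V E &
      ([set F | schrodinger_eigenvalue V F /\ (F < E)%R] #= `I_n.-1)%card].

(* Continuity selects, in the L^2 class of the eigenfunction, the only
   representative whose pointwise values and derivative are meaningful. *)
Definition normalised_eigenfunction V E psi : Prop :=
  [/\ continuous psi, schrodinger V psi (fun x => E * psi x),
      (\int[mu]_x ((psi x) ^+ 2)%:E = 1)%E &
      \forall x \near +oo, 0 < psi x].

End SchrodingerOperator.

Section Estimates.
Context {R : realType}.

Definition weight_bound (V W : R -> R) (a b C : R) : Prop :=
  forall x : R, x != 0 ->
    W x <= C * `|x| `^ a * V x `^ b /\
    (\int[@lebesgue_measure R]_(t in `[(- `|x|)%R, `|x|%R]) (W t)%:E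
       <= (C * `|x| `^ (a + 1) * V x `^ b)%:E)%E.

Definition eigenfunction_density (psi : R -> R) (E x : R) : R :=
  psi x ^+ 2 + derive1 psi x ^+ 2 / E.

End Estimates.

(* Main.v *)
Require Import Defs.
From mathcomp Require Import all_boot all_order all_algebra.
From mathcomp Require Import all_classical all_reals all_analysis.
From mathcomp Require Import measurable_realfun ring lra.
Import Order.TTheory GRing.Theory Num.Theory.
Import numFieldNormedType.Exports.
Local Open Scope classical_set_scope.
Local Open Scope ring_scope.

(* Integrating three times the L^2 convergence that defines the operator shows
   that an eigenfunction psi is a classical solution of psi'' = (V - E) psi.
   Everything else is a comparison of derivatives for this equation. To the right
   of the turning point the flux psi psi' increases and, psi being square
   integrable, stays nonpositive; hence psi ^ 2 and psi' ^ 2 decrease there, the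
   total energy is at most E, and sqrt E times the turning point is bounded below
   (uncertainty principle). Well inside, psi' ^ 2 + (E - V) psi ^ 2 is comparable
   to its value at 0, which is therefore at most a multiple of E / |{V <= E}|.
   Well outside, the flux decays like exp (- 2 int sqrt (V - E)). In the weighted
   integral, the inner part uses the bound on the integral of W; the rest uses the
   pointwise bound on W, against the total mass near the turning points and
   against the exponential decay beyond them. *)

Set Implicit Arguments.
Unset Strict Implicit.
Unset Printing Implicit Defensive.

(** * Calculus on the real line *)

Section Calculus.
Context {R : realType}.
Implicit Types (f g df dg p : R -> R) (a b x : R).

(** The constants may depend on [kappa] only, so every estimate respects scaling: lengths are
    measured by the turning point [t], derivatives by [sqrt E]. The flux argument alone gives the
    prefactor [1 / (sqrt E * t ^ 2)]; the lower bound on [t * sqrt E] turns it into [1 / t], and it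
    also makes [|x| * sqrt (V x)] dominate a multiple of [|x| / t], so that the exponential beats
    the polynomial growth of the weight. That uncertainty bound needs no Fourier transform: energy
    at most [E] leaves at most half of the mass where [V >= 2 E], and [psi ^ 2 <= 3 sqrt E] limits
    what the remaining interval can hold. The three regions of the weighted integral are forced.
    Near 0 the weight may be singular, only its integral is controlled, and [psi] must be bounded
    pointwise. Near the turning points [psi ^ 2] may exceed every fixed multiple of [1 / t] (for the
    harmonic oscillator it does as [n] grows), so only its mass and energy can be used, and the
    weight must be bounded pointwise. *)

Lemma is_derive_continuous f x d : is_derive x 1 f d -> {for x, continuous f}.
Proof.
by move=> fd; apply: differentiable_continuous; apply/derivable1_diffP; case: fd.
Qed.

(** Derivatives are required in the open interval only, because later comparisons start at 0, where
    the potential is continuous but possibly not differentiable. *)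
Lemma derive_ge0_le f df a b : a <= b ->
  (forall x, a <= x <= b -> {for x, continuous f}) ->
  (forall x, a < x < b -> is_derive x 1 f (df x)) ->
  (forall x, a < x < b -> 0 <= df x) -> f a <= f b.
Proof.
rewrite le_eqVlt => /predU1P[->//|ab] cf fd df0.
have fd' x : x \in `]a, b[ -> is_derive x 1 f (df x) by rewrite in_itv /= => /fd.
have cf' : {within `[a, b], continuous f}.
  by apply: continuous_in_subspaceT => x; rewrite inE /= in_itv /= => /cf.
have [c cab fab] := MVT ab fd' cf'.
rewrite -subr_ge0 fab mulr_ge0 ?df0 ?(itvP cab)//.
by rewrite subr_ge0 ltW.
Qed.

Lemma derive_le_increment f g df dg a b : a <= b ->
  (forall x, a <= x <= b -> {for x, continuous f}) ->
  (forall x, a <= x <= b -> {for x, continuous g}) ->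
  (forall x, a < x < b -> is_derive x 1 f (df x)) ->
  (forall x, a < x < b -> is_derive x 1 g (dg x)) ->
  (forall x, a < x < b -> df x <= dg x) -> f b - f a <= g b - g a.
Proof.
move=> ab cf cg fd gd dfg.
suff : g a - f a <= g b - f b by lra.
apply: (@derive_ge0_le (g - f) (fun x => dg x - df x)) => //.
- by move=> x xab; apply: continuousB; [exact: cg|exact: cf].
- by move=> x xab; apply: is_deriveB; [exact: gd|exact: fd].
- by move=> x /dfg; rewrite subr_ge0.
Qed.

Lemma derive_ge_increment f df a b (m : R) : a <= b ->
  (forall x, a <= x <= b -> is_derive x 1 f (df x)) ->
  (forall x, a <= x <= b -> m <= df x) -> m * (b - a) <= f b - f a.
Proof.
move=> ab fd dfm.
have := @derive_le_increment (fun x => x * m) f (fun=> m) df _ _ ab.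
rewrite -mulrBl mulrC; apply.
- by move=> x _; apply: (@is_derive_continuous _ _ (1 * m)); rewrite mul1r;
    apply: is_derive_eq; rewrite ?scaler0 ?add0r ?addr0 ?/(_ *: _) /= ?mulr1.
- by move=> x /fd; exact: is_derive_continuous.
- by move=> x _; apply: is_derive_eq; rewrite ?scaler0 ?add0r ?addr0 ?/(_ *: _) /= ?mulr1.
- by move=> x /andP[ax xb]; apply: fd; rewrite !ltW.
- by move=> x /andP[ax xb]; apply: dfm; rewrite !ltW.
Qed.

Lemma derive_le_increment_cst f df a b (m : R) : a <= b ->
  (forall x, a <= x <= b -> is_derive x 1 f (df x)) ->
  (forall x, a <= x <= b -> df x <= m) -> f b - f a <= m * (b - a).
Proof.
move=> ab fd dfm.
have := @derive_ge_increment (fun x => - f x) (fun x => - df x) a b (- m) ab.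
rewrite mulNr opprK => H; suff : - (m * (b - a)) <= - f b + f a by lra.
apply: H => x /[dup] xI.
- by move=> /fd ?; apply: is_deriveN.
- by rewrite lerN2; exact: dfm.
Qed.

Lemma derive0_cst f a b :
  (forall x, Num.min a b <= x <= Num.max a b -> is_derive x 1 f 0) -> f a = f b.
Proof.
wlog ab : a b / a <= b => [H fd|fd].
  have [ab|ba] := leP a b; first exact: H.
  by apply/esym/H; [exact: ltW|rewrite minC maxC].
rewrite (min_idPl ab) (max_idPr ab) in fd.
have cf x : a <= x <= b -> {for x, continuous f}.
  by move=> /fd; exact: is_derive_continuous.
have cst_c x : {for x, continuous (cst 0 : R -> R)} by exact: cst_continuous.
have fd' x : a < x < b -> is_derive x 1 f 0.
  by move=> /andP[? ?]; apply: fd; rewrite !ltW.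
apply/eqP; rewrite -subr_eq0 eq_le; apply/andP; split.
- have := @derive_le_increment (cst 0) f (fun=> 0) (fun=> 0) a b ab.
  rewrite subrr -opprB oppr_le0; apply => // x _; exact: is_derive_cst.
- have := @derive_le_increment f (cst 0) (fun=> 0) (fun=> 0) a b ab.
  rewrite subrr -opprB oppr_ge0; apply => // x _; exact: is_derive_cst.
Qed.

(** The fundamental theorem of calculus is applied on bounded intervals [[- N, N]]. Subtracting the
    value at 0 makes the primitives for different [N] agree wherever both are defined, so letting
    [N] grow with [|x|] glues them together. *)
Lemma primitive_exists f : continuous f ->
  exists F : R -> R, F 0 = 0 /\ forall x, is_derive x 1 F (f x).
Proof.
move=> cf.
pose I N x : R := (\int[lebesgue_measure]_(t in [set` `[(- N)%R, x]]) f t)%R.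
pose Fn N x : R := I N x - I N 0.
have Fd N x : 0 < N -> - N < x < N -> is_derive x 1 (Fn N) (f x).
  move=> N0 /andP[Nx xN].
  have : derivable (I N) x 1 /\ derive1 (I N) x = f x.
    apply: (@continuous_FTC1_closed _ f (- N) x N) => //; last exact: cf.
    apply: continuous_compact_integrable; first exact: segment_compact.
    by apply: continuous_subspaceT => y; exact: cf.
  rewrite derive1E => -[dI IE].
  have : is_derive x 1 (I N) (f x) by apply: DeriveDef.
  move=> ?; rewrite -[f x]subr0.
  exact: (@is_deriveB _ _ _ (I N) (cst (I N 0))).
have Feq N M x : 0 < N -> 0 < M -> - N < x < N -> - M < x < M -> Fn N x = Fn M x.
  move=> N0 M0 xN xM; apply/eqP; rewrite -subr_eq0.
  have -> : 0 = (Fn N - Fn M) 0 by rewrite !fctE /Fn !subrr.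
  apply/eqP; apply: (@derive0_cst (Fn N - Fn M)) => y yx.
  rewrite -(subrr (f y)); apply: is_deriveB; apply: Fd => //;
    case: (leP x 0) yx => x0; lra.
exists (fun x => Fn (`|x| + 1) x); split; first by rewrite /Fn subrr.
(* The fixed bound [|x| + 2] serves every [y] at distance less than 1 from [x], so near [x] the
   glued function is a single primitive. *)
move=> x; apply: (@near_eq_is_derive _ _ _ (Fn (`|x| + 2))).
- have xI : nbhs x [set y | `|x - y| < 1] by exact: (@nbhsx_ballx _ _ x 1).
  near=> y.
  have : `|x - y| < 1 by near: y.
  move=> xy; apply: Feq; [by rewrite ltr_wpDl|by rewrite ltr_wpDl| |];
    move: xy; case: (ler0P x); case: (ler0P y); case: (ler0P (x - y)) => *; lra.
- by apply: Fd; [rewrite ltr_wpDl|case: (ler0P x) => *; lra].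
Unshelve. all: by end_near. Qed.

(* Monotone exhaustion by compact intervals, so that [p] may be unbounded or
   [S] unbounded. *)
Lemma ge0_integral_primitive_le (S : set R) (u v : nat -> R) p P (M : R) :
  {homo v : n m / (n <= m)%N >-> n <= m} ->
  {homo u : n m / (n <= m)%N >-> m <= n} ->
  (forall n, u n < v n) ->
  S = \bigcup_n `[u n, v n]%classic ->
  (forall x, S x -> is_derive x 1 P (p x)) ->
  (forall x, S x -> {for x, continuous p}) ->
  (forall x, S x -> 0 <= p x) ->
  (forall a b, S a -> S b -> P b - P a <= M) ->
  (\int[lebesgue_measure]_(x in S) (p x)%:E <= M%:E)%E.
Proof.
move=> vh uh uv SE Pd cp p0 PM.
have Sn n x : `[u n, v n]%classic x -> S x by rewrite SE => ?; exists n.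
have cpn n : {within `[u n, v n], continuous p}.
  by apply: continuous_in_subspaceT => x; rewrite inE => /Sn /cp.
have mI n : measurable_fun `[u n, v n] (fun x => (p x)%:E).
  by apply/measurable_EFinP; apply: subspace_continuous_measurable_fun.
have H : (\int[lebesgue_measure]_(x in `[u i, v i]) (p x)%:E
    @[i --> \oo] --> \int[lebesgue_measure]_(x in \bigcup_n `[u n, v n]%classic) (p x)%:E)%E.
  apply: ge0_nondecreasing_set_cvg_integral => //=.
  - apply/nondecreasing_seqP => n; rewrite subsetEset => x /=; rewrite !in_itv /=.
    by move=> /andP[a b]; rewrite (le_trans (uh _ _ (leqnSn n)))//
      (le_trans b (vh _ _ (leqnSn n))).
  - by move=> n x xn; rewrite lee_fin p0//; exact: Sn xn.
rewrite -SE in H.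
rewrite -(cvg_lim _ H)//; apply: lime_le; first by apply/cvg_ex; eexists; exact: H.
near=> n.
have Su : S (u n) by apply: (Sn n); rewrite /= in_itv /= lexx ltW.
have Sv : S (v n) by apply: (Sn n); rewrite /= in_itv /= lexx ltW.
rewrite (@continuous_FTC2 _ p P _ _ (uv n) (cpn n)).
- by rewrite -EFinD lee_fin PM.
- split.
  + move=> x xuv; have /Pd[] // : S x.
    by apply: (Sn n); rewrite /= in_itv /= !ltW ?(itvP xuv).
  + by apply: cvg_at_right_filter; apply: is_derive_continuous; exact: Pd.
  + by apply: cvg_at_left_filter; apply: is_derive_continuous; exact: Pd.
- move=> x xuv; rewrite derive1E.
  have /Pd[] // : S x by apply: (Sn n); rewrite /= in_itv /= !ltW ?(itvP xuv).
Unshelve. all: by end_near. Qed.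

Lemma ge0_integralT_primitive_le p P (M : R) : continuous p -> (forall x, 0 <= p x) ->
  (forall x, is_derive x 1 P (p x)) -> (forall a b, a <= b -> P b - P a <= M) ->
  (\int[lebesgue_measure]_x (p x)%:E <= M%:E)%E.
Proof.
move=> cp p0 dP PM; have M0 : 0 <= M by have := PM 0 0 (lexx 0); rewrite subrr.
apply: (@ge0_integral_primitive_le _ (fun n => - n.+1%:R) (fun n => n.+1%:R) p P).
- by move=> n m nm; rewrite ler_nat.
- by move=> n m nm; rewrite lerN2 ler_nat.
- by move=> n; apply: (@lt_trans _ _ 0); rewrite ?oppr_lt0 ltr0n.
- apply/esym; rewrite -subTset => x _.
  have [n _ xn] : exists2 n : nat, True & `|x| <= n.+1%:R.
    by exists (Num.trunc `|x|) => //; exact/ltW/truncnS_gt.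
  by exists n => //=; rewrite in_itv /= -ler_norml.
- by move=> x _; exact: cp.
- by move=> x _; exact: p0.
- move=> a b _ _; have [ab|ba] := leP a b; first exact: PM.
  apply: le_trans M0; rewrite subr_le0.
  apply: (derive_ge0_le (ltW ba)) (fun x _ => dP x) (fun x _ => p0 x) => x _.
  exact: is_derive_continuous (dP x).
Qed.

End Calculus.

(** * Power-like potentials *)

Section PowR.
Context {R : realType}.
Implicit Types x y r s : R.

Lemma powR_inv x r : 0 < x -> x^-1 `^ r = (x `^ r)^-1.
Proof. by move=> x0; rewrite -powR_inv1 ?ltW// -powRrM mulN1r powRN. Qed.

Lemma one_powR r : 1 `^ r = 1 :> R.
Proof. by rewrite powR1. Qed.

Lemma powR_div x y r : 0 < x -> 0 < y -> (y / x) `^ r = y `^ r / x `^ r.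
Proof. by move=> x0 y0; rewrite powRM ?invr_ge0 ?ltW// powR_inv. Qed.

Lemma powRK x r : r != 0 -> 0 <= x -> (x `^ r^-1) `^ r = x.
Proof. by move=> r0 x0; rewrite -powRrM mulVf// powRr1. Qed.

End PowR.

Section PowerLike.
Context {R : realType} (kappa : R) (kappa_ge1 : 1 <= kappa).
Implicit Types (U V : R -> R) (x y E : R).

Let kappa_gt0 : 0 < kappa := lt_le_trans ltr01 kappa_ge1.

Lemma power_like_gt0 U x : power_like kappa U -> 0 < x -> 0 < U x.
Proof. by move=> pU /pU[]. Qed.

Lemma power_like_is_derive U x : power_like kappa U -> 0 < x ->
  is_derive x 1 U (derive1 U x).
Proof. by move=> pU /pU[_ ? _ _]; rewrite derive1E; exact: derivableP. Qed.

Lemma power_like_bounds U x : power_like kappa U -> 0 < x ->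
  kappa^-1 * U x <= x * derive1 U x /\ x * derive1 U x <= kappa * U x.
Proof. by move=> pU /pU[_ _ _ /andP[]]. Qed.

(** With [r = - kappa] or [r = - kappa^-1] the bracket has a constant sign by the defining
    inequalities: [U z * z ^ (- kappa)] decreases and [U z * z ^ (- kappa^-1)] increases. The two
    growth bounds express this monotonicity. *)
Lemma power_like_mulr_powR_is_derive U (r x : R) : power_like kappa U -> 0 < x ->
  is_derive x 1 (fun z => U z * z `^ r)
    ((x * derive1 U x + r * U x) * x `^ (r - 1)).
Proof.
move=> pU x0; have dU := @power_like_is_derive U x pU x0.
have dr := @is_derive1_powR R r x x0.
apply: is_derive_eq; rewrite -?[_ *: _]/(_ * _).
have -> : x `^ r = x * x `^ (r - 1).
  rewrite -{2}(@powRr1 _ x (ltW x0)) -powRD ?subrKC//.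
  by rewrite (gt_eqF x0) implybT.
ring.
Qed.

Lemma power_like_upper U x y : power_like kappa U -> 0 < x -> x <= y ->
  U y <= (y / x) `^ kappa * U x.
Proof.
move=> pU x0 xy; have y0 := lt_le_trans x0 xy.
have : - (U x * x `^ (- kappa)) <= - (U y * y `^ (- kappa)).
  apply: (@derive_ge0_le _ (fun z => - (U z * z `^ (- kappa)))
     (fun z => - ((z * derive1 U z + - kappa * U z) * z `^ (- kappa - 1)))) => //.
  - move=> z /andP[xz _]; have z0 := lt_le_trans x0 xz.
    by apply: continuousN; apply: is_derive_continuous;
      exact: power_like_mulr_powR_is_derive.
  - move=> z /andP[xz _]; have z0 := lt_trans x0 xz.
    by apply: is_deriveN; exact: power_like_mulr_powR_is_derive.
  - move=> z /andP[xz _]; have z0 := lt_trans x0 xz.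
    rewrite oppr_ge0 mulr_le0_ge0 ?powR_ge0// mulNr subr_le0.
    by have [] := @power_like_bounds U z pU z0.
rewrite lerN2 !powRN ler_pdivrMr ?powR_gt0// powR_div//.
by rewrite mulrAC (mulrC (_ / _)) mulrA (mulrC (U x)).
Qed.

Lemma power_like_lower U x y : power_like kappa U -> 0 < x -> x <= y ->
  (y / x) `^ kappa^-1 * U x <= U y.
Proof.
move=> pU x0 xy; have y0 := lt_le_trans x0 xy.
have : U x * x `^ (- kappa^-1) <= U y * y `^ (- kappa^-1).
  apply: (@derive_ge0_le _ (fun z => (U z * z `^ (- kappa^-1)))
     (fun z => ((z * derive1 U z + - kappa^-1 * U z) * z `^ (- kappa^-1 - 1)))) => //.
  - move=> z /andP[xz _]; have z0 := lt_le_trans x0 xz.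
    by apply: is_derive_continuous; exact: power_like_mulr_powR_is_derive.
  - move=> z /andP[xz _]; have z0 := lt_trans x0 xz.
    exact: power_like_mulr_powR_is_derive.
  - move=> z /andP[xz _]; have z0 := lt_trans x0 xz.
    rewrite mulr_ge0 ?powR_ge0// mulNr subr_ge0.
    by have [] := @power_like_bounds U z pU z0.
rewrite !powRN ler_pdivlMr ?powR_gt0// powR_div//.
by rewrite mulrAC (mulrC (_ / _)) mulrA (mulrC (U x)).
Qed.

Lemma power_like_le U x y : power_like kappa U -> 0 < x -> x <= y -> U x <= U y.
Proof.
move=> pU x0 xy; have Ux := power_like_gt0 pU x0.
apply: le_trans (@power_like_lower U x y pU x0 xy).
rewrite ler_peMl ?(ltW Ux)// -[leLHS](one_powR kappa^-1).
have yx : 1 <= y / x by rewrite ler_pdivlMr// mul1r.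
by rewrite ge0_ler_powR ?nnegrE// ?invr_ge0 ?ltW// (lt_le_trans ltr01).
Qed.

Lemma power_like_lt U x y : power_like kappa U -> 0 < x -> x < y -> U x < U y.
Proof.
move=> pU x0 xy; have Ux := power_like_gt0 pU x0.
apply: lt_le_trans (@power_like_lower U x y pU x0 (ltW xy)).
rewrite ltr_pMl// -[ltLHS](one_powR kappa^-1).
have yx : 1 < y / x by rewrite ltr_pdivlMr// mul1r.
by rewrite gt0_ltr_powR ?nnegrE ?invr_gt0// ltW// (lt_trans ltr01).
Qed.

End PowerLike.

Section PotentialClass.
Context {R : realType} (kappa : R) (kappa_ge1 : 1 <= kappa).
Implicit Types (V : R -> R) (x y E : R).

Let kappa_gt0 : 0 < kappa := lt_le_trans ltr01 kappa_ge1.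

(** This symmetry reduces estimates on the left half-line to estimates on the right one. *)
Lemma potential_class_opp V :
  potential_class kappa V -> potential_class kappa (fun x => V (- x)).
Proof.
move=> [V0 VO VN Vp Vn]; split => //; first by rewrite oppr0.
by under eq_fun do rewrite opprK.
Qed.

Lemma potential_gt0 V x : potential_class kappa V -> x != 0 -> 0 < V x.
Proof.
move=> [_ _ _ Vp Vn]; rewrite neq_lt => /orP[x0|x0].
  have nx : 0 < - x by rewrite oppr_gt0.
  by have := power_like_gt0 Vn nx; rewrite opprK.
exact: power_like_gt0 Vp x0.
Qed.

Lemma potential_le V x y : potential_class kappa V -> 0 <= x -> x <= y -> V x <= V y.
Proof.
move=> [V0 VO _ Vp _]; rewrite le_eqVlt => /predU1P[<- _|]; first by rewrite VO.
exact: (power_like_le kappa_ge1).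
Qed.

Lemma potential_oppr_ge V x : potential_class kappa V -> V x <= kappa * V (- x).
Proof. by move=> [_ _ /(_ (- x))]; rewrite opprK. Qed.

Lemma potential_norm_le V x : potential_class kappa V ->
  V x <= kappa * V `|x| /\ V `|x| <= kappa * V x.
Proof.
move=> cV; have [V0 _ VN _ _] := cV.
have H y : V y <= kappa * V y by rewrite ler_peMl.
case: (ger0P x) => _; split; rewrite ?H ?VN//.
exact: potential_oppr_ge.
Qed.

Lemma potential_small V E : potential_class kappa V -> 0 < E ->
  exists2 d, 0 < d & forall x, 0 <= x <= d -> V x <= E.
Proof.
move=> cV E0; have [_ _ _ Vp _] := cV.
have V1 := power_like_gt0 Vp ltr01.
(* For [0 < x <= 1] the lower growth bound between [x] and 1 reads [V x <= x ^ kappa^-1 * V 1],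
   which is at most [E] once [x <= (E / V 1) ^ kappa]. *)
pose d := Num.min 1 ((E / V 1) `^ kappa).
have q0 : 0 < E / V 1 by rewrite divr_gt0.
have d0 : 0 < d by rewrite lt_min ltr01 powR_gt0.
exists d => // x /andP[x0 xd].
apply: le_trans (potential_le cV x0 xd) _.
have d1 : d <= 1 by rewrite ge_min lexx.
have := power_like_lower Vp d0 d1; rewrite div1r powR_inv// ler_pdivrMl ?powR_gt0//.
move/le_trans; apply.
suff : d `^ kappa^-1 <= E / V 1 by rewrite ler_pdivlMr.
have -> : E / V 1 = ((E / V 1) `^ kappa) `^ kappa^-1.
  by rewrite -powRrM mulfV ?gt_eqF// powRr1// ltW.
rewrite ge0_ler_powR ?nnegrE ?powR_ge0 ?invr_ge0 ?(ltW d0) ?(ltW kappa_gt0)//.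
by rewrite ge_min lexx orbT.
Qed.

Lemma potential_continuous V : potential_class kappa V -> continuous V.
Proof.
move=> cV x; have [VO] := cV => V0 VN Vp Vn.
have [x0|x0|->] := ltgtP x 0.
- have nx : 0 < - x by rewrite oppr_gt0.
  have cN := is_derive_continuous (power_like_is_derive Vn nx).
  have -> : V = (fun y => V (- y)) \o -%R by apply/funext => y /=; rewrite opprK.
  by apply: continuous_comp; [exact: opp_continuous|exact: cN].
- exact: is_derive_continuous (power_like_is_derive Vp x0).
- apply/cvgrPdist_le => e e0; rewrite V0.
  have [d d0 dV] := potential_small cV e0.
  have [d' d'0 dV'] := potential_small (potential_class_opp cV) e0.
  have : nbhs (0 : R) [set y | `|0 - y| < Num.min d d'].
    by apply: (@nbhsx_ballx _ _ (0 : R)); rewrite lt_min d0.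
  apply: filterS => y /=; rewrite !sub0r !normrN lt_min => /andP[yd yd'].
  rewrite ger0_norm//; case: (ger0P y) yd yd' => y0 yd yd'.
    by rewrite dV// y0 ltW.
  by rewrite -(opprK y) dV'// oppr_ge0 !ltW.
Qed.

Lemma turning_point V E : potential_class kappa V -> 0 < E ->
  exists2 t, 0 < t & V t = E.
Proof.
move=> cV E0; have [_ V0 _ Vp _] := cV.
have V1 := power_like_gt0 Vp ltr01.
(* The growth bound from 1 to [y = q ^ kappa] gives [V y >= q * V 1 = V 1 + E]; the summand 1
   ensures [y >= 1], where that bound applies. *)
pose q := 1 + E / V 1.
have q1 : 1 <= q by rewrite lerDl divr_ge0// ltW.
have q0 : 0 < q by exact: lt_le_trans q1.
pose y := q `^ kappa.
have y1 : 1 <= y by rewrite /y -[leLHS](powRr0 q) ler_powR// ltW.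
have Vy : E <= V y.
  apply: le_trans (power_like_lower Vp ltr01 y1).
  rewrite divr1 /y -powRrM mulfV ?gt_eqF// powRr1 ?(ltW q0)//.
  by rewrite mulrDl mul1r divfK ?gt_eqF// lerDr ltW.
have [|t /itvP tI tE] := @IVT _ V 0 y E (le_trans ler01 y1)
  (continuous_subspaceT (potential_continuous cV)).
  by rewrite V0 ge_min le_max (ltW E0) Vy orbT.
exists t => //; rewrite lt_neqAle tI andbT.
by apply: contra_eqN tE => /eqP <-; rewrite V0 lt_eqF.
Qed.

End PotentialClass.

(** * The Schrodinger equation *)

Section SchrodingerODE.
Context {R : realType}.
Implicit Types (V psi dpsi P : R -> R) (E x y : R).

(* [dpsi] stands for the derivative of [psi], and [P] for a primitive of
   [psi ^+ 2]: carrying them along turns integral estimates into comparisons of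
   derivatives. *)
Definition normalised_solution V E psi dpsi P : Prop :=
  [/\ forall x, is_derive x 1 psi (dpsi x),
      forall x, is_derive x 1 dpsi ((V x - E) * psi x),
      forall x, is_derive x 1 P (psi x ^+ 2),
      forall a b, a <= b -> P b - P a <= 1 &
      exists2 A, 0 < A & 3 / 4 <= P A - P (- A)].

Lemma is_derive_reflect (f : R -> R) x d :
  is_derive (- x) 1 f d -> is_derive x 1 (fun z => f (- z)) (- d).
Proof.
move=> fd; have := @is_derive1_comp R f -%R x d (-1) _ _.
by rewrite mulrN1; apply; apply: is_deriveNid.
Qed.

Lemma normalised_solution_reflect V E psi dpsi P :
  normalised_solution V E psi dpsi P ->
  normalised_solution (fun x => V (- x)) E (fun x => psi (- x))
    (fun x => - dpsi (- x)) (fun x => - P (- x)).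
Proof.
move=> [d1 d2 d3 P1 [A A0 PA]]; split.
- by move=> x; exact: is_derive_reflect.
- by move=> x; rewrite -[X in is_derive _ _ _ X]opprK; apply: is_deriveN; exact: is_derive_reflect.
- by move=> x; rewrite -[X in is_derive _ _ _ X]opprK; apply: is_deriveN; exact: is_derive_reflect.
- by move=> a b ab; rewrite opprK addrC P1// lerN2.
- by exists A => //; rewrite !opprK addrC.
Qed.

Context (V psi dpsi P : R -> R) (E : R).
Context (sol : normalised_solution V E psi dpsi P).

Let G x := psi x * dpsi x.
(** Adding [E * P] cancels the term [- E * psi ^ 2] in the derivative of the flux, so [D] is a
    primitive of the energy density [psi' ^ 2 + V * psi ^ 2]. *)
Let D x := G x + E * P x.

Let dpsi1 x : is_derive x 1 psi (dpsi x). Proof. by case: sol. Qed.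
Let dpsi2 x : is_derive x 1 dpsi ((V x - E) * psi x). Proof. by case: sol. Qed.
Let dP x : is_derive x 1 P (psi x ^+ 2). Proof. by case: sol. Qed.

Let dG x : is_derive x 1 G (dpsi x ^+ 2 + (V x - E) * psi x ^+ 2).
Proof.
have i1 := dpsi1 x; have i2 := dpsi2 x; rewrite /G.
by apply: is_derive_eq; rewrite -?[_ *: _]/(_ * _); ring.
Qed.

Let df x : is_derive x 1 (fun z => psi z ^+ 2) (2 * G x).
Proof.
have i1 := dpsi1 x; have i2 := dpsi2 x; under eq_fun do rewrite expr2.
by apply: is_derive_eq; rewrite -?[_ *: _]/(_ * _) /G; ring.
Qed.

Let dd x : is_derive x 1 (fun z => dpsi z ^+ 2) (2 * (V x - E) * G x).
Proof.
have i1 := dpsi1 x; have i2 := dpsi2 x; under eq_fun do rewrite expr2.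
by apply: is_derive_eq; rewrite -?[_ *: _]/(_ * _) /G; ring.
Qed.

Let dD x : is_derive x 1 D (dpsi x ^+ 2 + V x * psi x ^+ 2).
Proof.
have i1 := dG x; have i2 := dP x.
have : is_derive x 1 (fun z => E * P z) (E * psi x ^+ 2).
  by apply: is_derive_eq; rewrite -?[_ *: _]/(_ * _); ring.
by move=> ?; rewrite /D; apply: is_derive_eq; ring.
Qed.

Let P_le1 a b : a <= b -> P b - P a <= 1. Proof. by case: sol => _ _ _ + _; apply. Qed.

Lemma solution_primitive_homo : {homo P : x y / x <= y}.
Proof.
move=> x y xy; apply: (@derive_ge0_le _ P (fun z => psi z ^+ 2)) => // z _.
  exact: is_derive_continuous (dP z).
exact: sqr_ge0.
Qed.

Lemma solution_flux_le x y : x <= y -> (forall z, x <= z <= y -> E <= V z) ->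
  G x <= G y.
Proof.
move=> xy EV; apply: (@derive_ge0_le _ _ _ _ _ xy _ (fun z _ => dG z)) => [z _|z zI].
  exact: is_derive_continuous (dG z).
by rewrite addr_ge0 ?sqr_ge0// mulr_ge0 ?sqr_ge0// subr_ge0 EV// !ltW//; case/andP: zI.
Qed.

(* Otherwise [psi ^+ 2] would be bounded below by a positive constant on a
   half-line. *)
Lemma solution_flux_le0 x : (forall y, x <= y -> E <= V y) -> G x <= 0.
Proof.
move=> EV; rewrite leNgt; apply/negP => G0.
have Gm y : x <= y -> G x <= G y.
  by move=> xy; apply: solution_flux_le => // z /andP[xz _]; exact: EV.
have fm y : x + 1 <= y -> 2 * G x <= psi y ^+ 2.
  move=> xy; have xy' : x <= y by lra.
  have := @derive_ge_increment _ (fun z => psi z ^+ 2) _ x y (2 * G x) xy'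
    (fun z _ => df z) _.
  move=> /(_ _)/wrap[z /andP[xz _]|H]; first by have := Gm z xz; lra.
  have := sqr_ge0 (psi x); nra.
(* Over a length [(G x)^-1] the lower bound [2 * G x] on [psi ^ 2] produces mass 2, whereas the
   total mass is at most 1. *)
have T0 : 0 < (G x)^-1 by rewrite invr_gt0.
have yT : x + 1 <= x + 1 + (G x)^-1 by lra.
have := @derive_ge_increment _ P _ _ _ (2 * G x) yT (fun z _ => dP z) _.
move=> /(_ _)/wrap[z /andP[xz _]|]; first exact: fm.
rewrite [X in 2 * G x * X]addrC addKr -mulrA mulfV ?gt_eqF//.
by have := P_le1 yT; lra.
Qed.

Lemma solution_sqr_nonincr a x y : (forall z, a <= z -> E <= V z) ->
  a <= x -> x <= y -> psi y ^+ 2 <= psi x ^+ 2.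
Proof.
move=> EV ax xy; rewrite -lerN2.
apply: (@derive_ge0_le _ (fun z => - psi z ^+ 2) (fun z => - (2 * G z))) => //.
- by move=> z _; apply: continuousN; exact: is_derive_continuous (df z).
- by move=> z _; apply: is_deriveN; exact: df.
- move=> z /andP[xz _]; have : G z <= 0; last by lra.
  by apply: solution_flux_le0 => u zu; apply: EV; lra.
Qed.

Lemma solution_derive_sqr_nonincr a x y : (forall z, a <= z -> E <= V z) ->
  a <= x -> x <= y -> dpsi y ^+ 2 <= dpsi x ^+ 2.
Proof.
move=> EV ax xy; rewrite -lerN2.
apply: (@derive_ge0_le _ (fun z => - dpsi z ^+ 2)
  (fun z => - (2 * (V z - E) * G z))) => //.
- by move=> z _; apply: continuousN; exact: is_derive_continuous (dd z).
- by move=> z _; apply: is_deriveN; exact: dd.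
- move=> z /andP[xz _]; have G0 : G z <= 0.
    by apply: solution_flux_le0 => u zu; apply: EV; lra.
  have EVz : E <= V z by apply: EV; lra.
  by rewrite oppr_ge0 mulr_ge0_le0//; lra.
Qed.

(** Monotonicity turns the mass of [[x, y]] into a pointwise bound at its right end; the same device
    bounds [psi'] through the energy. *)
Lemma solution_sqr_tail a x y : (forall z, a <= z -> E <= V z) ->
  a <= x -> x <= y -> (y - x) * psi y ^+ 2 <= 1.
Proof.
move=> EV ax xy; rewrite mulrC.
apply: le_trans (P_le1 xy); apply: derive_ge_increment => // [z _|z /andP[xz zy]].
  exact: dP.
by apply: (solution_sqr_nonincr EV) => //; lra.
Qed.

Context (V_ge0 : forall x, 0 <= V x).

Lemma solution_energy_homo : {homo D : x y / x <= y}.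
Proof.
move=> x y xy; apply: (@derive_ge0_le _ D _ _ _ xy _ (fun z _ => dD z)) => z _.
  exact: is_derive_continuous (dD z).
by rewrite addr_ge0 ?sqr_ge0// mulr_ge0 ?sqr_ge0.
Qed.

Lemma solution_derive_sqr_tail a x y : (forall z, a <= z -> E <= V z) ->
  a <= x -> x <= y -> (y - x) * dpsi y ^+ 2 <= D y - D x.
Proof.
move=> EV ax xy; rewrite mulrC.
apply: (derive_ge_increment xy (fun z _ => dD z)) => // z /andP[xz zy].
rewrite -[leLHS]addr0; apply: lerD; last by rewrite mulr_ge0 ?sqr_ge0.
by apply: (solution_derive_sqr_nonincr EV) => //; lra.
Qed.

End SchrodingerODE.

(** * Global bounds: sign of the eigenvalue, total energy, sup norm, uncertainty principle *)

Section Eigenfunctions.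
Context {R : realType} (kappa : R) (kappa_ge1 : 1 <= kappa).
Context (V psi dpsi P : R -> R) (E : R).
Context (cV : potential_class kappa V).
Context (sol : normalised_solution V E psi dpsi P).
Implicit Types x y z : R.

Let V_ge0 x : 0 <= V x. Proof. by case: cV. Qed.
Let G x := psi x * dpsi x.
Let D x := G x + E * P x.

Lemma solution_flux_ge0 x : (forall y, y <= x -> E <= V y) -> 0 <= G x.
Proof.
move=> EV; have := @solution_flux_le0 _ _ _ _ _ _ (normalised_solution_reflect sol) (- x).
rewrite opprK mulrN oppr_le0; apply => y xy; apply: EV; lra.
Qed.

(* If [E <= 0] then [psi ^+ 2] is both nonincreasing and nondecreasing. *)
Lemma eigenvalue_gt0 : 0 < E.
Proof.
rewrite ltNge; apply/negP => E0.
have EV x : E <= V x by exact: le_trans E0 _.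
have G0 x : G x = 0.
  apply/eqP; rewrite eq_le solution_flux_ge0// andbT.
  exact: (solution_flux_le0 sol).
have [dpsi1 dpsi2 dP P1 [A A0 PA]] := sol.
have f0 x : psi 0 ^+ 2 = psi x ^+ 2.
  apply: (@derive0_cst _ (fun z => psi z ^+ 2)) => y _.
  under eq_fun do rewrite expr2.
  have i1 := dpsi1 y.
  apply: is_derive_eq; rewrite -?[_ *: _]/(_ * _).
  by move: (G0 y); rewrite /G => ->; rewrite addr0.
have PE a b : a <= b -> psi 0 ^+ 2 * (b - a) <= P b - P a.
  move=> ab; apply: (derive_ge_increment ab (fun z _ => dP z)) => z _.
  by rewrite -f0.
have PE' a b : a <= b -> P b - P a <= psi 0 ^+ 2 * (b - a).
  move=> ab; apply: (derive_le_increment_cst ab (fun z _ => dP z)) => z _.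
  by rewrite -f0.
have := PE' (- A) A ltac:(lra); have := sqr_ge0 (psi 0).
move=> f00 PA1; have f0_gt0 : 0 < psi 0 ^+ 2 by nra.
(* A constant [psi ^ 2] is nonzero since some bounded interval carries mass at least 3/4, and then
   an interval of length [2 / psi 0 ^ 2] has mass 2, more than the allowed 1. *)
have q0 : 0 <= 2 / psi 0 ^+ 2 by rewrite divr_ge0.
have := PE 0 (2 / psi 0 ^+ 2) q0; have := P1 0 (2 / psi 0 ^+ 2) q0.
have : psi 0 ^+ 2 * (2 / psi 0 ^+ 2) = 2 by rewrite mulrC divfK ?gt_eqF.
by rewrite subr0; lra.
Qed.

Let EV_mono t x : 0 <= t -> E <= V t -> t <= x -> E <= V x.
Proof. by move=> t0 Et tx; apply: le_trans (potential_le kappa_ge1 cV t0 tx). Qed.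

Let cVN := potential_class_opp cV.

Let EV_monoN t x : 0 <= t -> E <= V (- t) -> x <= - t -> E <= V x.
Proof.
move=> t0 Et tx; apply: le_trans Et _; rewrite -[x]opprK.
by apply: (potential_le kappa_ge1 cVN); lra.
Qed.

(** Beyond both turning points the flux is nonpositive on the right and nonnegative on the left, so
    its boundary terms only lower [D A - D (- A)], and what remains is [E] times a mass.
    Monotonicity of [D] transfers the bound to any [x] and [y] inside [[- A, A]]. *)
Lemma solution_energy_le : {homo D : x y / x <= y} /\ forall x y, D y - D x <= E.
Proof.
have Dh : {homo D : x y / x <= y} := solution_energy_homo sol V_ge0; split => // x y.
have E0 := eigenvalue_gt0.
have [t t0 tE] := turning_point kappa_ge1 cV E0.
have [t' t'0 t'E] := turning_point kappa_ge1 cVN E0.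
pose A := t + t' + `|x| + `|y|.
have xA : - A <= x by rewrite /A; case: (ler0P x); case: (ler0P y) => *; lra.
have yA : y <= A by rewrite /A; case: (ler0P x); case: (ler0P y) => *; lra.
have nx := normr_ge0 x; have ny := normr_ge0 y.
have GA : G A <= 0.
  apply: (solution_flux_le0 sol) => z Az; apply: (@EV_mono t); [exact: ltW|by rewrite tE|].
  by rewrite /A in Az; lra.
have GNA : 0 <= G (- A).
  apply: solution_flux_ge0 => z zA; apply: (@EV_monoN t'); [exact: ltW|by rewrite t'E|].
  by rewrite /A in zA; lra.
have P1 : P A - P (- A) <= 1.
  by have [_ _ _ + _] := sol; apply; rewrite /A; lra.
have := Dh _ _ xA; have := Dh _ _ yA.
have : E * (P A - P (- A)) <= E by rewrite -[leRHS]mulr1 ler_pM2l.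
rewrite mulrBr => EP DA DNA.
apply: (@le_trans _ _ (D A - D (- A))); first lra.
by rewrite /D; lra.
Qed.

(** A one-dimensional Sobolev inequality. With [s = sqrt E], [- 2 psi psi' <= (psi' ^ 2 + s ^ 2 psi
    ^ 2) / s] integrates to at most [2 E / s = 2 s], one [E] coming from the energy and one from the
    mass; the starting value far to the right contributes the third [s]. *)
Lemma solution_sqr_le x : psi x ^+ 2 <= 3 * Num.sqrt E.
Proof.
have E0 := eigenvalue_gt0.
have [t t0 tE] := turning_point kappa_ge1 cV E0.
set s := Num.sqrt E; have s0 : 0 < s by rewrite sqrtr_gt0.
have sE : s ^+ 2 = E by rewrite sqr_sqrtr// ltW.
have [dpsi1 dpsi2 dP P1 _] := sol.
(* A distance [s^-1] past the turning point, the tail bound gives [psi y ^ 2 <= s]. *)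
pose b := t + `|x|; pose y := b + s^-1.
have nx := normr_ge0 x; have xb : x <= b by rewrite /b (le_trans (ler_norm x))// lerDr ltW.
have si0 : 0 < s^-1 by rewrite invr_gt0.
have by_ : b <= y by rewrite /y lerDl ltW.
have tail : s^-1 * psi y ^+ 2 <= 1.
  have -> : s^-1 = y - b by rewrite /y addrC addKr.
  apply: (@solution_sqr_tail _ V psi dpsi P E sol t) => //; last by rewrite /b; lra.
  by move=> z tz; apply: (@EV_mono t) tz; [exact: ltW|rewrite tE].
have xy : x <= y by lra.
have [Dh DE] := solution_energy_le.
have df z : is_derive z 1 (fun u => - psi u ^+ 2) (- (2 * G z)).
  have i1 := dpsi1 z; under eq_fun do rewrite expr2.
  by apply: is_derive_eq; rewrite -?[_ *: _]/(_ * _) /G; ring.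
have dH z : is_derive z 1 (fun u => s^-1 * (D u + E * P u))
    (s^-1 * ((dpsi z ^+ 2 + V z * psi z ^+ 2) + E * psi z ^+ 2)).
  have i1 := dpsi1 z; have i2 := dpsi2 z; have i3 := dP z; rewrite /D /G.
  by apply: is_derive_eq; rewrite -?[_ *: _]/(_ * _); ring.
have fxy : - psi y ^+ 2 - - psi x ^+ 2 <=
    (s^-1 * (D y + E * P y)) - (s^-1 * (D x + E * P x)).
  apply: (@derive_le_increment _ (fun z => - psi z ^+ 2)
    (fun z => s^-1 * (D z + E * P z)) (fun z => - (2 * G z))
    (fun z => s^-1 * ((dpsi z ^+ 2 + V z * psi z ^+ 2) + E * psi z ^+ 2))) => //.
  - by move=> z _; exact: is_derive_continuous (df z).
  - by move=> z _; exact: is_derive_continuous (dH z).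
  - move=> z _; rewrite ler_pdivlMl// -sE.
    have : 0 <= V z * psi z ^+ 2 by rewrite mulr_ge0 ?sqr_ge0.
    have := sqr_ge0 (dpsi z + s * psi z); have := sqr_ge0 (psi z); rewrite /G; nra.
have H1 : D y + E * P y - (D x + E * P x) <= 2 * E.
  have := DE x y; have : E * (P y - P x) <= E by rewrite -[leRHS]mulr1 ler_pM2l ?P1.
  by rewrite mulrBr; lra.
have H2 : s^-1 * (D y + E * P y - (D x + E * P x)) <= 2 * s.
  by rewrite ler_pdivrMl// mulrCA -expr2 sE.
rewrite mulrBr in H2.
have : psi y ^+ 2 <= s by rewrite ler_pdivrMl ?mulr1 in tail.
by lra.
Qed.

Lemma solution_uncertainty X : 0 < X -> 2 * E <= V X -> 2 * E <= V (- X) ->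
  1 / 24 <= X * Num.sqrt E.
Proof.
move=> X0 VX VNX; have E0 := eigenvalue_gt0.
have [dpsi1 dpsi2 dP P1 [A A0 PA]] := sol.
have [Dh DE] := solution_energy_le.
have dD z : is_derive z 1 D (dpsi z ^+ 2 + V z * psi z ^+ 2).
  have i1 := dpsi1 z; have i2 := dpsi2 z; have i3 := dP z; rewrite /D /G.
  by apply: is_derive_eq; rewrite -?[_ *: _]/(_ * _); ring.
have outer a b : a <= b -> (forall z, a <= z <= b -> 2 * E <= V z) ->
    2 * E * (P b - P a) <= D b - D a.
  move=> ab EV; rewrite mulrBr.
  have dEP z : is_derive z 1 (fun u => 2 * E * P u) (2 * E * psi z ^+ 2).
    have i1 := dP z.
    by apply: is_derive_eq; rewrite -?[_ *: _]/(_ * _); ring.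
  apply: (@derive_le_increment _ (fun z => 2 * E * P z) D
    (fun z => 2 * E * psi z ^+ 2) (fun z => dpsi z ^+ 2 + V z * psi z ^+ 2)) => //.
  - by move=> z _; exact: is_derive_continuous (dEP z).
  - by move=> z _; exact: is_derive_continuous (dD z).
  - move=> z zI; rewrite -[leLHS]add0r lerD ?sqr_ge0//.
    by rewrite ler_wpM2r ?sqr_ge0// EV// !ltW//; case/andP: zI.
pose B := A + X.
have oR := @outer X B; have oL := @outer (- B) (- X).
have {}oR : 2 * E * (P B - P X) <= D B - D X.
  apply: oR => [|z /andP[Xz _]]; first by rewrite /B; lra.
  by apply: le_trans VX (potential_le kappa_ge1 cV _ Xz); exact: ltW.
have {}oL : 2 * E * (P (- X) - P (- B)) <= D (- X) - D (- B).
  apply: oL => [|z /andP[_ zX]]; first by rewrite /B; lra.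
  rewrite -[z]opprK; apply: le_trans VNX (potential_le kappa_ge1 cVN _ _); lra.
have inner : P X - P (- X) <= 3 * Num.sqrt E * (X - - X).
  have NXX : - X <= X by lra.
  by apply: (derive_le_increment_cst NXX (fun z _ => dP z)) => z _; exact: solution_sqr_le.
have DX : D (- X) <= D X by apply: Dh; lra.
have DB := DE (- B) B.
have PB : 3 / 4 <= P B - P (- B).
  have /(solution_primitive_homo sol) : A <= B by rewrite /B; lra.
  have /(solution_primitive_homo sol) : - B <= - A by rewrite /B; lra.
  lra.
(* Outside [[- X, X]] the mass is at most 1/2, so at least [3/4 - 1/2 = 1/4] lies inside, where it
   is at most [6 * X * sqrt E]. Hence the constant 1/24. *)
have : 2 * E * ((P B - P X) + (P (- X) - P (- B))) <= 2 * E * (1 / 2) by lra.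
by rewrite ler_pM2l ?mulr_gt0//; lra.
Qed.

End Eigenfunctions.

(** * Pointwise bounds well inside and well outside the classically allowed region *)

Section EigenfunctionBounds.
Context {R : realType} (kappa : R) (kappa_ge1 : 1 <= kappa).
Implicit Types (V psi dpsi P : R -> R) (E x y z t u : R).

(** The local energy [Q = psi' ^ 2 + (E - V) * psi ^ 2] has derivative [- V' * psi ^ 2]. As
    [V' >= 0] to the right of 0, [Q] decreases there, while [Q + m * V] increases as long as
    [psi ^ 2 <= m]. *)
Lemma solution_discriminant_right V psi dpsi P E x :
  potential_class kappa V -> normalised_solution V E psi dpsi P -> 0 <= x ->
  dpsi x ^+ 2 + (E - V x) * psi x ^+ 2 <= dpsi 0 ^+ 2 + E * psi 0 ^+ 2 /\
  forall m, (forall y, 0 < y < x -> psi y ^+ 2 <= m) ->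
    dpsi 0 ^+ 2 + E * psi 0 ^+ 2 <=
      dpsi x ^+ 2 + (E - V x) * psi x ^+ 2 + m * V x.
Proof.
move=> cV sol x0; have [_ VO _ Vp _] := cV; have [d1 d2 _ _ _] := sol.
pose Q y := dpsi y ^+ 2 + (E - V y) * psi y ^+ 2.
have df z : is_derive z 1 (fun u => psi u ^+ 2) (2 * psi z * dpsi z).
  have i1 := d1 z; under eq_fun do rewrite expr2.
  by apply: is_derive_eq; rewrite -?[_ *: _]/(_ * _); ring.
have dd z : is_derive z 1 (fun u => dpsi u ^+ 2) (2 * (V z - E) * psi z * dpsi z).
  have i1 := d2 z; under eq_fun do rewrite expr2.
  by apply: is_derive_eq; rewrite -?[_ *: _]/(_ * _); ring.
have dQ z : 0 < z -> is_derive z 1 Q (- (derive1 V z * psi z ^+ 2)).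
  move=> z0; have i1 := df z; have i2 := dd z; have i3 := power_like_is_derive Vp z0.
  by rewrite /Q; apply: is_derive_eq; rewrite -?[_ *: _]/(_ * _); ring.
have cQ z : {for z, continuous Q}.
  apply: continuousD; first exact: is_derive_continuous (dd z).
  apply: continuousM; last exact: is_derive_continuous (df z).
  apply: continuousB; first exact: cst_continuous.
  exact: (potential_continuous kappa_ge1 cV).
have V'0 z : 0 < z -> 0 <= derive1 V z.
  move=> z0; have [zV _] := power_like_bounds Vp z0.
  have Vz := power_like_gt0 Vp z0.
  have : 0 < z * derive1 V z.
    by apply: lt_le_trans zV; rewrite mulr_gt0// invr_gt0 (lt_le_trans ltr01).
  by rewrite pmulr_rgt0//; exact: ltW.
have <- : Q 0 = dpsi 0 ^+ 2 + E * psi 0 ^+ 2 by rewrite /Q VO subr0.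
rewrite -/(Q x); split => [|m fm].
  rewrite -lerN2.
  apply: (@derive_ge0_le _ (fun z => - Q z) (fun z => derive1 V z * psi z ^+ 2) _ _ x0).
  - by move=> z _; apply: continuousN; exact: cQ.
  - move=> z /andP[z0 _]; rewrite -[X in is_derive _ _ _ X]opprK.
    by apply: is_deriveN; exact: dQ.
  - by move=> z /andP[z0 _]; rewrite mulr_ge0 ?V'0 ?sqr_ge0.
have : Q 0 + m * V 0 <= Q x + m * V x; last by rewrite VO mulr0 addr0.
apply: (@derive_ge0_le _ (fun z => Q z + m * V z)
  (fun z => derive1 V z * (m - psi z ^+ 2)) _ _ x0).
- move=> z _; apply: continuousD; first exact: cQ.
  apply: continuousM; first exact: cst_continuous.
  exact: (potential_continuous kappa_ge1 cV).
- move=> z /andP[z0 _]; have i1 := dQ z z0; have i2 := power_like_is_derive Vp z0.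
  by apply: is_derive_eq; rewrite -?[_ *: _]/(_ * _); ring.
- by move=> z /[dup] zx /andP[z0 _]; rewrite mulr_ge0 ?V'0// subr_ge0 fm.
Qed.

Lemma solution_discriminant_le V psi dpsi P E x :
  potential_class kappa V -> normalised_solution V E psi dpsi P ->
  dpsi x ^+ 2 + (E - V x) * psi x ^+ 2 <= dpsi 0 ^+ 2 + E * psi 0 ^+ 2.
Proof.
move=> cV sol; have [x0|x0] := leP 0 x.
  by have [] := solution_discriminant_right cV sol x0.
have x0' : 0 <= - x by rewrite oppr_ge0 ltW.
have [] := solution_discriminant_right (potential_class_opp cV)
  (normalised_solution_reflect sol) x0'.
by rewrite opprK oppr0 !sqrrN.
Qed.

(** Where [V <= E / 4], the decrease of the local energy from its value [Q0] at 0 gives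
    [psi ^ 2 <= 2 * Q0 / E]; this in turn limits the loss to [(2 * Q0 / E) * (E / 4) = Q0 / 2]. So
    the local energy stays above [Q0 / 2] on [[0, r]], and its integral there is at most [2 * E],
    from the total energy and the mass. *)
Lemma solution_discriminant0_le V psi dpsi P E r :
  potential_class kappa V -> normalised_solution V E psi dpsi P ->
  0 < r -> V r <= E / 4 -> (dpsi 0 ^+ 2 + E * psi 0 ^+ 2) * r <= 4 * E.
Proof.
move=> cV sol r0 Vr.
have E0 := eigenvalue_gt0 cV sol.
have [Dh DE] := solution_energy_le kappa_ge1 cV sol.
have [d1 d2 dP P1 _] := sol.
set Q0 := dpsi 0 ^+ 2 + _ * _.
have Q00 : 0 <= Q0 by rewrite addr_ge0 ?sqr_ge0// mulr_ge0 ?sqr_ge0 ?ltW.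
have Vz z : 0 <= z <= r -> V z <= E / 4.
  by move=> /andP[z0 zr]; apply: le_trans Vr; exact: (potential_le kappa_ge1 cV).
have fz z : 0 <= z <= r -> psi z ^+ 2 <= 2 * Q0 / E.
  move=> /Vz Vz4; have := solution_discriminant_le z cV sol; rewrite -/Q0 => Qz.
  have f0 := sqr_ge0 (psi z); have g0 := sqr_ge0 (dpsi z).
  by rewrite ler_pdivlMr//; nra.
pose H z := (psi z * dpsi z + E * P z) + E * P z.
have dH z : is_derive z 1 H (dpsi z ^+ 2 + V z * psi z ^+ 2 + E * psi z ^+ 2).
  have i1 := d1 z; have i2 := d2 z; have i3 := dP z; rewrite /H.
  by apply: is_derive_eq; rewrite -?[_ *: _]/(_ * _); ring.
have Hr : Q0 / 2 * (r - 0) <= H r - H 0.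
  apply: (derive_ge_increment (ltW r0) (fun z _ => dH z)) => z zI.
  have z0 : 0 <= z by case/andP: zI.
  have [_ /(_ (2 * Q0 / E))] := solution_discriminant_right cV sol z0.
  rewrite -/Q0 => Qz.
  have {}Qz : Q0 <= dpsi z ^+ 2 + (E - V z) * psi z ^+ 2 + 2 * Q0 / E * V z.
    (* The bound [m = 2 * Q0 / E] on [psi ^ 2] is available on all of [[0, z]] because [V] increases
       there. *)
    by apply: Qz => y /andP[y0 yz]; apply: fz; case/andP: zI; lra.
  have : 2 * Q0 / E * V z <= Q0 / 2.
    have -> : Q0 / 2 = 2 * Q0 / E * (E / 4) by field; rewrite gt_eqF.
    by rewrite ler_wpM2l ?Vz// !mulr_ge0// invr_ge0 ltW.
  have Vz0 : 0 <= V z * psi z ^+ 2.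
    by rewrite mulr_ge0 ?sqr_ge0//; case: cV.
  lra.
have : E * (P r - P 0) <= E by rewrite -[leRHS]mulr1 ler_pM2l ?P1 ?ltW.
by have := DE 0 r; rewrite /H in Hr; rewrite mulrBr; lra.
Qed.

Lemma solution_density_inner V psi dpsi P E r x :
  potential_class kappa V -> normalised_solution V E psi dpsi P ->
  0 < r -> V r <= E / 4 -> V (- r) <= E / 4 -> `|x| <= r ->
  psi x ^+ 2 + dpsi x ^+ 2 / E <= 8 / r.
Proof.
move=> cV sol r0 Vr VNr xr.
have E0 := eigenvalue_gt0 cV sol.
have Vx : V x <= E / 4.
  have [x0|x0] := leP 0 x.
    by apply: le_trans Vr; apply: (potential_le kappa_ge1 cV x0); rewrite -(ger0_norm x0).
  rewrite -[x]opprK; apply: le_trans VNr.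
  have x0' : 0 <= - x by rewrite oppr_ge0 ltW.
  have xr' : - x <= r by rewrite -(ltr0_norm x0).
  exact: (potential_le kappa_ge1 (potential_class_opp cV) x0' xr').
have Q0 := solution_discriminant0_le cV sol r0 Vr.
have Qx := solution_discriminant_le x cV sol.
have f0 := sqr_ge0 (psi x); have g0 := sqr_ge0 (dpsi x).
rewrite -(@ler_pM2r _ (E * r)) ?mulr_gt0//.
have -> : 8 / r * (E * r) = 8 * E by field; rewrite gt_eqF.
have -> : (psi x ^+ 2 + dpsi x ^+ 2 / E) * (E * r) =
  (E * psi x ^+ 2 + dpsi x ^+ 2) * r by field; rewrite gt_eqF.
have : (E * psi x ^+ 2 + dpsi x ^+ 2) <=
  2 * (dpsi 0 ^+ 2 + E * psi 0 ^+ 2) by nra.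
by move=> /(ler_wpM2r (ltW r0)); rewrite -mulrA; lra.
Qed.

(* The flux [psi * dpsi] is nonpositive on the right of the turning point and,
   by AM-GM, its derivative is at least [2 s] times its absolute value. *)
Lemma solution_density_decay V psi dpsi P E a z y x s :
  potential_class kappa V -> normalised_solution V E psi dpsi P ->
  (forall u, a <= u -> E <= V u) -> a < z -> z <= y -> y < x -> 0 < s ->
  E <= s ^+ 2 -> (forall u, z <= u <= x -> s ^+ 2 <= V u - E) ->
  psi x ^+ 2 + dpsi x ^+ 2 / E <=
    2 / (Num.sqrt E * (x - y) * (z - a)) * expR (- (2 * s * (y - z))).
Proof.
move=> cV sol EV az zy yx s0 Es sV.
have E0 := eigenvalue_gt0 cV sol.
have [Dh DE] := solution_energy_le kappa_ge1 cV sol.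
have [d1 d2 dP P1 _] := sol.
have V0 u : 0 <= V u by case: cV.
pose G u := psi u * dpsi u.
have dG u : is_derive u 1 G (dpsi u ^+ 2 + (V u - E) * psi u ^+ 2).
  have i1 := d1 u; have i2 := d2 u; rewrite /G.
  by apply: is_derive_eq; rewrite -?[_ *: _]/(_ * _); ring.
have G0 u : a <= u -> G u <= 0.
  by move=> au; apply: (solution_flux_le0 sol) => v uv; apply: EV; lra.
set e := Num.sqrt E; have e0 : 0 < e by rewrite sqrtr_gt0.
have eE : e ^+ 2 = E by rewrite sqr_sqrtr// ltW.
(* Mass and energy to the right of [a] bound [psi z ^ 2] by [1 / (z - a)] and [psi' z ^ 2] by
   [E / (z - a)]; then [2 * e * |psi psi'| <= psi' ^ 2 + e ^ 2 * psi ^ 2]. *)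
have Gz : - G z <= e / (z - a).
  have fz := solution_sqr_tail sol EV (lexx a) (ltW az).
  have dz := solution_derive_sqr_tail sol V0 EV (lexx a) (ltW az).
  have {}dz : (z - a) * dpsi z ^+ 2 <= e ^+ 2.
    by rewrite eE; apply: le_trans dz _; exact: DE.
  rewrite ler_pdivlMr ?subr_gt0// -(@ler_pM2l _ (2 * e)) ?mulr_gt0//.
  have H := sqr_ge0 (dpsi z + e * psi z); rewrite /G.
  have za : 0 < z - a by rewrite subr_gt0.
  have : (z - a) * (dpsi z ^+ 2 + e ^+ 2 * psi z ^+ 2 + 2 * e * (psi z * dpsi z)) >= 0.
    by rewrite mulr_ge0 ?(ltW za)//; nra.
  have : e ^+ 2 * ((z - a) * psi z ^+ 2) <= e ^+ 2 * 1 by rewrite ler_wpM2l ?sqr_ge0.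
  by lra.
(* The differential inequality [G' + 2 * s * G >= 0] says that [h] increases. *)
pose h u := G u * expR (2 * s * u).
have dh u : is_derive u 1 h
    ((dpsi u ^+ 2 + (V u - E) * psi u ^+ 2 + 2 * s * G u) * expR (2 * s * u)).
  have i1 := dG u.
  have i2 : is_derive u 1 (fun v => expR (2 * s * v)) (2 * s * expR (2 * s * u)).
    have i3 : is_derive u 1 (fun v => 2 * s * v) (2 * s).
      by apply: is_derive_eq; rewrite -?[_ *: _]/(_ * _); ring.
    rewrite [2 * s * expR _]mulrC.
    exact: (@is_derive1_comp R expR (fun v => 2 * s * v)).
  by rewrite /h; apply: is_derive_eq; rewrite -?[_ *: _]/(_ * _); ring.
have hzy : h z <= h y.
  apply: (@derive_ge0_le _ h _ _ _ zy _ (fun u _ => dh u)) => u uzy.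
    exact: is_derive_continuous (dh u).
  rewrite mulr_ge0 ?expR_ge0//.
  have : s ^+ 2 <= V u - E by apply: sV; lra.
  have := sqr_ge0 (psi u); have := sqr_ge0 (dpsi u + s * psi u); rewrite /G; nra.
have Gy : - G y <= e / (z - a) * expR (- (2 * s * (y - z))).
  have -> : - (2 * s * (y - z)) = 2 * s * z - 2 * s * y by ring.
  rewrite expRB mulrA ler_pdivlMr ?expR_gt0//.
  apply: (@le_trans _ _ (- G z * expR (2 * s * z))).
    by rewrite !mulNr lerN2.
  by rewrite ler_wpM2r ?expR_ge0.
(* The way back from the flux to the function: the increment of [G] over [[y, x]] is the integral of
   [psi' ^ 2 + (V - E) * psi ^ 2], and by monotonicity both squares are at least their values at
   [x]. *)
have sx : s ^+ 2 * psi x ^+ 2 * (x - y) + dpsi x ^+ 2 * (x - y) <= - G y.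
  rewrite -mulrDl.
  apply: (@le_trans _ _ (G x - G y)); last by have := G0 x; lra.
  apply: (derive_ge_increment (ltW yx) (fun z _ => dG z)) => u /andP[yu ux].
  rewrite addrC lerD//.
    by apply: (solution_derive_sqr_nonincr sol EV) => //; lra.
  apply: ler_pM; rewrite ?sqr_ge0//; first by apply: sV; lra.
  by apply: (solution_sqr_nonincr sol EV) => //; lra.
have yx0 : 0 < x - y by rewrite subr_gt0.
have za : 0 < z - a by rewrite subr_gt0.
apply: (@le_trans _ _ (2 / (E * (x - y)) * (- G y))).
  rewrite -(@ler_pM2l _ (E * (x - y))) ?mulr_gt0//.
  have -> : E * (x - y) * (2 / (E * (x - y)) * - G y) = 2 * (- G y).
    by field; rewrite !gt_eqF//; lra.
  have -> : E * (x - y) * (psi x ^+ 2 + dpsi x ^+ 2 / E) =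
    E * psi x ^+ 2 * (x - y) + dpsi x ^+ 2 * (x - y) by field; rewrite gt_eqF.
  have : E * psi x ^+ 2 * (x - y) <= s ^+ 2 * psi x ^+ 2 * (x - y).
    by rewrite ler_wpM2r ?(ltW yx0)// ler_wpM2r ?sqr_ge0.
  by have := G0 y; lra.
have -> : 2 / (e * (x - y) * (z - a)) * expR (- (2 * s * (y - z))) =
  2 / (E * (x - y)) * (e / (z - a) * expR (- (2 * s * (y - z)))).
  by rewrite -eE; field; rewrite !gt_eqF//; lra.
by rewrite ler_wpM2l// divr_ge0// ltW// mulr_gt0.
Qed.

End EigenfunctionBounds.

(** * Regularity of eigenfunctions *)

Section Regularity.
Context {R : realType}.
Implicit Types (V f g h p psi P S H df : R -> R) (a b x y E : R).
Local Notation mu := (@lebesgue_measure R).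

Lemma ge0_primitive_le_integral p P a b : continuous p -> (forall x, 0 <= p x) ->
  (forall x, is_derive x 1 P (p x)) -> a <= b ->
  ((P b - P a)%:E <= \int[mu]_x (p x)%:E)%E.
Proof.
move=> cp p0 dP; rewrite le_eqVlt => /predU1P[->|ab].
  by rewrite subrr integral_ge0// => x _; rewrite lee_fin.
have mp : measurable_fun setT (fun x => (p x)%:E).
  by apply/measurable_EFinP; exact: continuous_measurable_fun.
have -> : (P b - P a)%:E = (\int[mu]_(x in `[a, b]) (p x)%:E)%E.
  rewrite (@continuous_FTC2 _ p P _ _ ab) ?EFinB//.
  - by apply: continuous_subspaceT.
  - split.
    + by move=> x _; case: (dP x).
    + by apply: cvg_at_right_filter; exact: is_derive_continuous (dP a).
    + by apply: cvg_at_left_filter; exact: is_derive_continuous (dP b).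
  - by move=> x _; rewrite derive1E; case: (dP x).
by apply: ge0_subset_integral => // x _; rewrite lee_fin.
Qed.

Lemma Lnorm2_primitive_le g S a b (e : R) : continuous g -> 0 <= e ->
  (Lnorm mu 2%:E (EFin \o g) <= e%:E)%E ->
  (forall x, is_derive x 1 S (g x ^+ 2)) -> a <= b -> S b - S a <= e ^+ 2.
Proof.
move=> cg e0 ge dS ab; rewrite -lee_fin.
apply: (@le_trans _ _ (\int[mu]_x (g x ^+ 2)%:E)%E).
  apply: ge0_primitive_le_integral => // [x|x]; last exact: sqr_ge0.
  by apply: continuousM; exact: cg.
have -> : (\int[mu]_x (g x ^+ 2)%:E = \int[mu]_x `|(EFin \o g) x| `^ 2)%E.
  apply: eq_integral => x _ /=.
  by rewrite powR_mulrn// real_normK// num_real.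
rewrite -powR_Lnorm//.
have -> : (e ^+ 2)%:E = (e%:E `^ 2)%E by rewrite poweR_EFin powR_mulrn.
by apply: gt0_ler_poweR => //; rewrite in_itv /= leey andbT ?lee_fin ?Lnorm_ge0.
Qed.

(* [|g| <= e / 2 + g ^ 2 / (2 e)] trades the L^2 norm for a local L^1 bound
   without Hoelder's inequality. *)
Lemma L2_small_primitive (g1 g2 h H : R -> R) (A M e : R) :
  continuous g1 -> continuous g2 -> 0 < e -> 0 <= M -> 0 <= A ->
  (Lnorm mu 2%:E (EFin \o g1) <= e%:E)%E ->
  (Lnorm mu 2%:E (EFin \o g2) <= e%:E)%E ->
  (forall x, is_derive x 1 H (h x)) ->
  (forall x, `|x| <= A -> `|h x| <= `|g1 x| + M * `|g2 x|) ->
  forall x, `|x| <= A -> `|H x - H 0| <= (1 + M) * e * (A + 1).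
Proof.
move=> c1 c2 e0 M0 A0 n1 n2 dH hg x xA.
have csq g : continuous g -> continuous (fun x => g x ^+ 2).
  by move=> cg y; apply: continuousM; exact: cg.
have [S1 [_ dS1]] := primitive_exists (csq _ c1).
have [S2 [_ dS2]] := primitive_exists (csq _ c2).
pose S y := (1 + M) * e / 2 * y + (S1 y + M * S2 y) / (2 * e).
have dS y : is_derive y 1 S
    ((e / 2 + g1 y ^+ 2 / (2 * e)) + M * (e / 2 + g2 y ^+ 2 / (2 * e))).
  have i1 := dS1 y; have i2 := dS2 y; rewrite /S.
  by apply: is_derive_eq; rewrite -?[_ *: _]/(_ * _); field; rewrite gt_eqF.
have amgm (t : R) : `|t| <= e / 2 + t ^+ 2 / (2 * e).
  rewrite -(@ler_pM2r _ (2 * e)) ?mulr_gt0//.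
  have -> : (e / 2 + t ^+ 2 / (2 * e)) * (2 * e) = e ^+ 2 + t ^+ 2.
    by field; rewrite gt_eqF.
  by have := sqr_ge0 (`|t| - e); have := real_normK (num_real t); nra.
have hS y : `|y| <= A ->
    `|h y| <= (e / 2 + g1 y ^+ 2 / (2 * e)) + M * (e / 2 + g2 y ^+ 2 / (2 * e)).
  by move=> /hg /le_trans; apply; rewrite lerD// ler_wpM2l.
have key a b : - A <= a -> a <= b -> b <= A -> `|H b - H a| <= S b - S a.
  move=> Aa ab bA; rewrite ler_norml; apply/andP; split.
    rewrite lerNl opprB -[H a]opprK addrC.
    have := @derive_le_increment _ (fun y => - H y) S _ _ a b ab
      _ _ (fun y _ => is_deriveN (dH y)) (fun y _ => dS y).
    have -> : - H b - - H a = - - H a - H b by ring.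
    apply.
    - by move=> y _; exact: is_derive_continuous (is_deriveN (dH y)).
    - by move=> y _; exact: is_derive_continuous (dS y).
    - move=> y yab; have /hS : `|y| <= A by rewrite ler_norml; lra.
      by rewrite ler_norml => /andP[]; lra.
  apply: (@derive_le_increment _ H S _ _ a b ab
      _ _ (fun y _ => dH y) (fun y _ => dS y)).
  - by move=> y _; exact: is_derive_continuous (dH y).
  - by move=> y _; exact: is_derive_continuous (dS y).
  - move=> y yab; have /hS : `|y| <= A by rewrite ler_norml; lra.
    by rewrite ler_norml => /andP[]; lra.
have Sle a b : a <= b -> b - a <= A -> S b - S a <= (1 + M) * e * (A + 1).
  move=> ab bA.
  have s1 := Lnorm2_primitive_le c1 (ltW e0) n1 dS1 ab.
  have s2 := Lnorm2_primitive_le c2 (ltW e0) n2 dS2 ab.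
  have : (S1 b + M * S2 b) / (2 * e) - (S1 a + M * S2 a) / (2 * e) <= (1 + M) * e / 2.
    rewrite -mulrBl ler_pdivrMr ?mulr_gt0//.
    have : M * (S2 b - S2 a) <= M * e ^+ 2 by rewrite ler_wpM2l.
    rewrite mulrBr; lra.
  have : (1 + M) * e / 2 * (b - a) <= (1 + M) * e / 2 * A.
    by rewrite ler_wpM2l// divr_ge0// mulr_ge0 ?addr_ge0 ?(ltW e0).
  have : 0 <= (1 + M) * e * (A + 1) by rewrite !mulr_ge0 ?addr_ge0 ?(ltW e0).
  rewrite mulrBr /S; lra.
move: xA; rewrite ler_norml => /andP[Ax xA].
have [x0|x0] := leP 0 x.
  by apply: le_trans (key 0 x _ _ _) (Sle _ _ _ _) => //; lra.
rewrite distrC.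
by apply: le_trans (key x 0 _ _ _) (Sle _ _ _ _) => //; lra.
Qed.

Lemma derive_norm_increment f df (A m : R) : 0 <= A ->
  (forall x, `|x| <= A -> is_derive x 1 f (df x)) ->
  (forall x, `|x| <= A -> `|df x| <= m) ->
  forall x, `|x| <= A -> `|f x - f 0| <= m * A.
Proof.
move=> A0 fd dfm x xA.
have m0 : 0 <= m by apply: le_trans (normr_ge0 _) (dfm 0 _); rewrite normr0.
have key a b : - A <= a -> a <= b -> b <= A -> b - a <= A -> `|f b - f a| <= m * A.
  move=> Aa ab bA baA.
  have xI z : a <= z <= b -> `|z| <= A by rewrite ler_norml; lra.
  have up := derive_le_increment_cst ab (fun z zI => fd z (xI z zI)) (m := m).
  have lo := derive_ge_increment ab (fun z zI => fd z (xI z zI)) (m := - m).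
  have {}up : f b - f a <= m * (b - a).
    by apply: up => z /xI /dfm; rewrite ler_norml => /andP[].
  have {}lo : - m * (b - a) <= f b - f a.
    by apply: lo => z /xI /dfm; rewrite ler_norml => /andP[].
  have : m * (b - a) <= m * A by rewrite ler_wpM2l.
  rewrite ler_norml; rewrite mulNr in lo; lra.
move: xA; rewrite ler_norml => /andP[Ax xA].
have [x0|x0] := leP 0 x; first by apply: key; lra.
by rewrite distrC; apply: key; lra.
Qed.

End Regularity.

Section EigenfunctionRegularity.
Context {R : realType}.
Implicit Types (V f g h p phi psi P S H df : R -> R) (a b x y z E : R).
Local Notation mu := (@lebesgue_measure R).
Local Notation norm2 f := (Lnorm mu 2%:E (EFin \o f%R)).

Lemma L2_cvg_le (u_ : nat -> R -> R) (u : R -> R) (e : R) : 0 < e -> L2_cvg u_ u ->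
  \forall k \near \oo, (norm2 (u_ k \- u) <= e%:E)%E.
Proof.
move=> e0 uu.
have N0 : nbhs (0 : \bar R)%E [set y : \bar R | (y < e%:E)%E].
  apply: open_nbhs_nbhs; split; first exact: open_ereal_lt_ereal.
  by rewrite /= lte_fin.
have : \forall k \near \oo, (norm2 (u_ k \- u) < e%:E)%E by exact: uu _ N0.
by apply: filterS => k; exact: ltW.
Qed.

Lemma test_function_is_derive phi (k : nat) x : test_function phi ->
  is_derive x 1 (derive1n k phi) (derive1n k.+1 phi x).
Proof. by move=> [/(_ k x) d _]; rewrite derive1nS derive1E; exact: derivableP. Qed.

(* Three integrations turn the L^2 convergence of [- phi_k'' + V phi_k] into
   pointwise convergence, up to the quadratic polynomials
   [phi_k 0 * x + phi_k' 0 * x ^ 2 / 2]. *)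
Lemma primitive_quadratic_approx V (phi psi : R -> R) E
    (Psi G0 G1 G2 : R -> R) (A M e : R) :
  continuous V -> continuous psi -> test_function phi ->
  (forall x, is_derive x 1 Psi (psi x)) -> Psi 0 = 0 ->
  (forall x, is_derive x 1 G0 ((V x - E) * psi x)) -> G0 0 = 0 ->
  (forall x, is_derive x 1 G1 (G0 x)) -> G1 0 = 0 ->
  (forall x, is_derive x 1 G2 (G1 x)) -> G2 0 = 0 ->
  0 < e -> 0 <= A -> 0 <= M -> (forall x, `|x| <= A -> `|V x| <= M) ->
  (norm2 (phi \- psi) <= e%:E)%E ->
  (norm2 ((fun x => - derive1n 2 phi x + V x * phi x)
      \- (fun x => E * psi x)) <= e%:E)%E ->
  forall x, `|x| <= A ->
    `|Psi x - G2 x - (phi 0 * x + derive1n 1 phi 0 * x ^+ 2 / 2)| <=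
      ((1 + M) * (A + 1) * A * A + (A + 1)) * e.
Proof.
move=> cV cpsi tphi dPsi Psi0 dG0 G00 dG1 G10 dG2 G20 e0 A0 M0 VM n1 n2 x xA.
have d0 y : is_derive y 1 phi (derive1n 1 phi y) := test_function_is_derive 0 y tphi.
have d1 y := test_function_is_derive 1 y tphi.
have d2 y := test_function_is_derive 2 y tphi.
have cphi : continuous phi by move=> y; exact: is_derive_continuous (d0 y).
have cphi2 : continuous (derive1n 2 phi).
  by move=> y; exact: is_derive_continuous (d2 y).
have c1 : continuous (phi \- psi).
  by move=> y; apply: continuousB; [exact: cphi|exact: cpsi].
have c2 : continuous ((fun x => - derive1n 2 phi x + V x * phi x)
      \- (fun x => E * psi x)).
  move=> y; apply: continuousB; last first.
    by apply: continuousM; [exact: cst_continuous|exact: cpsi].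
  apply: continuousD; first by apply: continuousN; exact: cphi2.
  by apply: continuousM; [exact: cV|exact: cphi].
(* The derivative [phi'' - (V - E) * psi] equals minus the second small function plus
   [V * (phi - psi)]; on [[- A, A]] the factor [V] costs [M]. *)
have step1 y : `|y| <= A ->
    `|derive1n 1 phi y - derive1n 1 phi 0 - G0 y| <= (1 + M) * e * (A + 1).
  have H z : is_derive z 1 (fun u => derive1n 1 phi u - G0 u)
      (derive1n 2 phi z - (V z - E) * psi z).
    by have i1 := d1 z; have i2 := dG0 z; apply: is_derive_eq.
  move=> yA; have := L2_small_primitive c2 c1 e0 M0 A0 n2 n1 H _ yA.
  rewrite G00 subr0 => /(_ _)/wrap[z zA|].
    apply: (@le_trans _ _ (`|- (((fun x => - derive1n 2 phi x + V x * phi x)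
      \- (fun x => E * psi x)) z)| + `|V z| * `|(phi \- psi) z|)).
      rewrite -normrM; apply: le_trans (ler_normD _ _).
      by rewrite le_eqVlt; apply/orP; left; apply/eqP; congr `|_|; rewrite /=; ring.
    by rewrite normrN lerD// ler_wpM2r// VM.
  by rewrite addrAC.
set d := (1 + M) * e * (A + 1) in step1.
(* The error is now uniform, so each further integration costs only a factor [A]. *)
have step2 y : `|y| <= A ->
    `|phi y - derive1n 1 phi 0 * y - G1 y - phi 0| <= d * A.
  have H z : is_derive z 1 (fun u => phi u - derive1n 1 phi 0 * u - G1 u)
      (derive1n 1 phi z - derive1n 1 phi 0 - G0 z).
    have i1 := d0 z; have i2 := dG1 z.
    by apply: is_derive_eq; rewrite -?[_ *: _]/(_ * _); ring.
  move=> yA; have := derive_norm_increment A0 (fun z _ => H z) step1 yA.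
  by rewrite G10 mulr0 !subr0.
(* [phi] is known to be close to [psi] in L^2 only; passing to primitives makes this comparison
   pointwise as well, which is the reason for the third integration. *)
have [Phi [Phi0 dPhi]] := primitive_exists cphi.
have step3 : `|Phi x - phi 0 * x - derive1n 1 phi 0 * x ^+ 2 / 2 - G2 x| <= d * A * A.
  have H z : is_derive z 1
      (fun u => Phi u - phi 0 * u - derive1n 1 phi 0 * u ^+ 2 / 2 - G2 u)
      (phi z - derive1n 1 phi 0 * z - G1 z - phi 0).
    have i1 := dPhi z; have i2 := dG2 z.
    have i3 : is_derive z 1 (fun u : R => u ^+ 2) (2 * z).
      under eq_fun do rewrite expr2.
      by apply: is_derive_eq; rewrite -?[_ *: _]/(_ * _); ring.
    by apply: is_derive_eq; rewrite -?[_ *: _]/(_ * _); field.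
  have := derive_norm_increment A0 (fun z _ => H z) step2 xA.
  by rewrite Phi0 G20 expr0n /= !mulr0 mul0r !subr0.
have step4 : `|Phi x - Psi x| <= e * (A + 1).
  have H z : is_derive z 1 (fun u => Phi u - Psi u) (phi z - psi z).
    by have i1 := dPhi z; have i2 := dPsi z; apply: is_derive_eq.
  have := L2_small_primitive c1 c1 e0 (lexx 0) A0 n1 n1 H _ xA.
  rewrite Phi0 Psi0 !subr0 addr0 mul1r; apply => z _.
  by rewrite mul0r addr0.
have -> : Psi x - G2 x - (phi 0 * x + derive1n 1 phi 0 * x ^+ 2 / 2) =
   (Phi x - phi 0 * x - derive1n 1 phi 0 * x ^+ 2 / 2 - G2 x) - (Phi x - Psi x).
  by ring.
apply: le_trans (ler_normB _ _) _; rewrite /d in step3; lra.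
Qed.

(** Regularity without distributions: [H = Psi - G2] is a locally uniform limit of polynomials
    [al * x + be * x ^ 2 / 2], hence is one of them. Differentiating
    [Psi = G2 + al * x + be * x ^ 2 / 2] shows that [psi] is differentiable, and once more that it
    solves the equation. *)
Lemma eigenfunction_normalised_solution kappa V E psi : 1 <= kappa ->
  potential_class kappa V -> normalised_eigenfunction V E psi ->
  exists P, normalised_solution V E psi (derive1 psi) P.
Proof.
move=> kappa_ge1 cpV [cpsi [_ _ [phi_ [tphi L1 L2]]] int1 _].
have cV := potential_continuous kappa_ge1 cpV.
have cg : continuous (fun x => (V x - E) * psi x).
  move=> x; apply: (@continuousM _ _ (fun y => V y - E) psi); last exact: cpsi.
  by apply: continuousB; [exact: cV|exact: cst_continuous].
have [Psi [Psi0 dPsi]] := primitive_exists cpsi.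
have [G0 [G00 dG0]] := primitive_exists cg.
have cG0 : continuous G0 by move=> x; exact: is_derive_continuous (dG0 x).
have [G1 [G10 dG1]] := primitive_exists cG0.
have cG1 : continuous G1 by move=> x; exact: is_derive_continuous (dG1 x).
have [G2 [G20 dG2]] := primitive_exists cG1.
pose H x := Psi x - G2 x.
have approx (A e : R) : 0 <= A -> 0 < e -> exists al be : R,
    forall x, `|x| <= A -> `|H x - (al * x + be * x ^+ 2 / 2)| <= e.
  move=> A0 e0.
  pose M := kappa * V A.
  have [V0 _ _ _ _] := cpV.
  have M0 : 0 <= M by rewrite mulr_ge0// (le_trans ler01).
  have VM x : `|x| <= A -> `|V x| <= M.
    move=> xA; rewrite ger0_norm//.
    have [Vx _] := potential_norm_le kappa_ge1 x cpV.
    apply: le_trans Vx _; rewrite ler_wpM2l ?(le_trans ler01)//.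
    exact: (potential_le kappa_ge1 cpV).
  pose C := (1 + M) * (A + 1) * A * A + (A + 1).
  have C0 : 0 < C.
    by rewrite ltr_wpDl ?ltr_wpDl// !mulr_ge0 ?addr_ge0.
  have eC : 0 < e / C by rewrite divr_gt0.
  have N1 := L2_cvg_le eC L1; have N2 := L2_cvg_le eC L2.
  have [k [n1 n2]] : exists k,
    (norm2 (phi_ k \- psi) <= (e / C)%:E)%E /\
    (norm2 ((fun x => - derive1n 2 (phi_ k) x + V x * phi_ k x)
      \- (fun x => E * psi x)) <= (e / C)%:E)%E.
    have [k _ kP] := filterI N1 N2; exists k; exact: (kP k (leqnn k)).
  exists (phi_ k 0), (derive1n 1 (phi_ k) 0) => x xA.
  have := primitive_quadratic_approx cV cpsi (tphi k) dPsi Psi0 dG0 G00 dG1 G10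
    dG2 G20 eC A0 M0 VM n1 n2 xA.
  have CE : C * (e / C) = e by rewrite mulrC divfK// gt_eqF.
  by rewrite -/C CE.
(* The values at 1 and -1 determine the two coefficients of such a polynomial, so closeness there
   controls the coefficients. *)
pose be := H 1 + H (- 1); pose al := (H 1 - H (- 1)) / 2.
have HE x : H x = al * x + be * x ^+ 2 / 2.
  apply/eqP; rewrite -subr_eq0 -normr_le0; apply/ler_addgt0Pr => e e0.
  rewrite add0r.
  (* This interval contains [x], 1 and -1. The constant coefficient of [C] accounts for the error at
     [x], the other two for the errors in the linear and quadratic coefficients. *)
  pose A := `|x| + 1.
  have A0 : 0 <= A by rewrite addr_ge0.
  pose C := 1 + A + A ^+ 2.
  have C0 : 0 < C by rewrite ltr_wpDr ?sqr_ge0// ltr_wpDr.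
  have eC : 0 < e / C by rewrite divr_gt0.
  have [p [q pq]] := approx A _ A0 eC.
  have H1 := pq 1 _; have HN1 := pq (- 1) _; have Hx := pq x _.
  have {}H1 : `|H 1 - (p + q / 2)| <= e / C.
    by move: H1; rewrite normr1 expr1n !mulr1; apply; rewrite lerDr.
  have {}HN1 : `|H (- 1) - (- p + q / 2)| <= e / C.
    by move: HN1; rewrite normrN1 sqrrN expr1n mulr1 mulrN1; apply; rewrite lerDr.
  have {}Hx : `|H x - (p * x + q * x ^+ 2 / 2)| <= e / C by apply: Hx; rewrite lerDl.
  have -> : H x - (al * x + be * x ^+ 2 / 2) =
      (H x - (p * x + q * x ^+ 2 / 2))
      + ((H (- 1) - (- p + q / 2)) - (H 1 - (p + q / 2))) / 2 * x
      - ((H (- 1) - (- p + q / 2)) + (H 1 - (p + q / 2))) / 2 * x ^+ 2.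
    by rewrite /al /be; field.
  have -> : e = e / C + e / C * A + e / C * A ^+ 2.
    by rewrite -{1}(mulr1 (e / C)) -!mulrDr divfK// gt_eqF.
  have xA : `|x| <= A by rewrite lerDl.
  apply: le_trans (ler_normB _ _) _; apply: lerD.
    apply: le_trans (ler_normD _ _) _; apply: lerD => //.
    rewrite normrM ler_pM// normrM (@ger0_norm _ 2^-1) ?invr_ge0//.
    have := ler_normB (H (- 1) - (- p + q / 2)) (H 1 - (p + q / 2)); lra.
  rewrite normrM normrX ler_pM ?exprn_ge0//.
    rewrite normrM (@ger0_norm _ 2^-1) ?invr_ge0//.
    have := ler_normD (H (- 1) - (- p + q / 2)) (H 1 - (p + q / 2)); lra.
  by rewrite lerXn2r ?nnegrE.
have psiE x : psi x = al + be * x + G1 x.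
  have i1 : is_derive x 1 Psi (al + be * x + G1 x).
    have -> : Psi = (fun y => al * y + be * y ^+ 2 / 2 + G2 y).
      by apply/funext => y; rewrite -HE subrK.
    have i2 := dG2 x.
    have i3 : is_derive x 1 (fun u : R => u ^+ 2) (2 * x).
      under eq_fun do rewrite expr2.
      by apply: is_derive_eq; rewrite -?[_ *: _]/(_ * _); ring.
    by apply: is_derive_eq; rewrite -?[_ *: _]/(_ * _); field.
  by have [_ <-] := i1; have [_ <-] := dPsi x.
have dpsi x : is_derive x 1 psi (be + G0 x).
  have -> : psi = (fun y => al + be * y + G1 y) by apply/funext.
  have i2 := dG1 x.
  by apply: is_derive_eq; rewrite -?[_ *: _]/(_ * _); ring.
have dE : derive1 psi = (fun x => be + G0 x).
  by apply/funext => x; rewrite derive1E; case: (dpsi x).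
have cpsi2 : continuous (fun x => psi x ^+ 2).
  by move=> x; apply: continuousM; exact: cpsi.
have [P [P0 dP]] := primitive_exists cpsi2.
have Pm : {homo P : x y / x <= y}.
  move=> x y xy; apply: (@derive_ge0_le _ P (fun z => psi z ^+ 2)) => // z _.
    exact: is_derive_continuous (dP z).
  exact: sqr_ge0.
exists P; split => //.
- by move=> x; rewrite dE.
- move=> x; rewrite dE; have i1 := dG0 x.
  by apply: is_derive_eq; rewrite -?[_ *: _]/(_ * _); ring.
- move=> a b ab; rewrite -lee_fin -int1.
  by apply: ge0_primitive_le_integral => // x; exact: sqr_ge0.
(* If every symmetric interval had mass below 3/4, the total mass would be at most 3/4 instead of
   1. *)
apply: contrapT => noA.
have PA (A : R) : 0 < A -> P A - P (- A) <= 3 / 4.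
  move=> A0; rewrite leNgt; apply/negP => /ltW PA; apply: noA.
  by exists A.
have : (\int[mu]_x (psi x ^+ 2)%:E <= (3 / 4)%:E)%E.
  apply: (ge0_integralT_primitive_le cpsi2 _ dP) => [x|a b ab]; first exact: sqr_ge0.
  pose A := `|a| + `|b| + 1.
  have A0 : 0 < A by rewrite ltr_wpDl ?addr_ge0.
  have bA : b <= A by have := ler_norm b; have := normr_ge0 a; rewrite /A; lra.
  have aA : - A <= a.
    by have := ler_norm (- a); rewrite normrN; have := normr_ge0 b; rewrite /A; lra.
  by have := PA A A0; have := Pm _ _ bA; have := Pm _ _ aA; lra.
by rewrite int1 lee_fin; lra.
Qed.

End EigenfunctionRegularity.

(** * Decay of eigenfunctions *)

Section Geometry.
Context {R : realType} (kappa : R) (kappa_ge1 : 1 <= kappa).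
Implicit Types (V psi dpsi P : R -> R) (E x y z t u r : R).

Let kappa_gt0 : 0 < kappa := lt_le_trans ltr01 kappa_ge1.

(** The one-sided growth bounds hold at [|x|]; the extra factor [kappa] pays for a possible
    reflection from [|x|] to [x]. *)
Lemma potential_norm_ge_growth V t x : potential_class kappa V -> 0 < t -> t <= `|x| ->
  kappa^-1 * (`|x| / t) `^ kappa^-1 * V t <= V x /\
  V x <= kappa * (`|x| / t) `^ kappa * V t.
Proof.
move=> cV t0 tx; have [_ _ _ Vp _] := cV.
have [VxN VNx] := potential_norm_le kappa_ge1 x cV.
have lo := power_like_lower Vp t0 tx; have up := power_like_upper Vp t0 tx.
split; first by rewrite -mulrA ler_pdivrMl//; exact: le_trans VNx.
by apply: le_trans VxN _; rewrite -mulrA ler_pM2l.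
Qed.

Lemma potential_norm_le_decay V t x : potential_class kappa V -> x != 0 -> `|x| <= t ->
  kappa^-1 * (`|x| / t) `^ kappa * V t <= V x /\
  V x <= kappa * (`|x| / t) `^ kappa^-1 * V t.
Proof.
move=> cV x0 xt; have [_ _ _ Vp _] := cV.
have nx : 0 < `|x| by rewrite normr_gt0.
have t0 : 0 < t by exact: lt_le_trans xt.
have [VxN VNx] := potential_norm_le kappa_ge1 x cV.
have lo := power_like_lower Vp nx xt; have up := power_like_upper Vp nx xt.
have xt_t : `|x| / t = (t / `|x|)^-1 by rewrite invf_div.
have tx0 : 0 < t / `|x| by rewrite divr_gt0.
rewrite xt_t !powR_inv//; split.
  rewrite -mulrA ler_pdivrMl//; apply: le_trans VNx.
  by rewrite ler_pdivrMl ?powR_gt0.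
apply: le_trans VxN _; rewrite -mulrA ler_pM2l//.
by rewrite ler_pdivlMl ?powR_gt0.
Qed.

Lemma powR_kappaK x : 0 <= x -> (x `^ kappa) `^ kappa^-1 = x.
Proof. by move=> x0; rewrite -powRrM mulfV ?gt_eqF// powRr1. Qed.

(** Dilating by [kappa ^ kappa] raises the potential by a factor at least
    [(kappa ^ kappa) ^ kappa^-1 = kappa], exactly what reflection may lose. *)
Lemma turning_points_comparable V E t t' : potential_class kappa V ->
  0 < E -> 0 < t -> 0 < t' -> V t = E -> V (- t') = E -> t' <= kappa `^ kappa * t.
Proof.
move=> cV E0 t0 t'0 tE t'E; rewrite leNgt; apply/negP => H.
have [_ _ _ _ Vn] := cV.
have k1 : 1 <= kappa `^ kappa by rewrite -[leLHS](powRr0 kappa) ler_powR// ltW.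
have kt0 : 0 < kappa `^ kappa * t by rewrite mulr_gt0// (lt_le_trans ltr01).
have := power_like_lt kappa_ge1 Vn kt0 H; rewrite t'E ltNge => /negP; apply.
have kt : t <= `|- (kappa `^ kappa * t)|.
  by rewrite normrN gtr0_norm// ler_peMl// ltW.
have [+ _] := potential_norm_ge_growth cV t0 kt.
rewrite normrN gtr0_norm// mulfK ?gt_eqF// powR_kappaK ?(ltW kappa_gt0)//.
by rewrite mulVf ?gt_eqF// mul1r tE.
Qed.

Lemma sublevel_length_eq V E t t' : potential_class kappa V ->
  0 < t -> 0 < t' -> V t = E -> V (- t') = E -> sublevel_length V E = t + t'.
Proof.
move=> cV t0 t'0 tE t'E; have [_ _ _ Vp Vn] := cV.
rewrite /sublevel_length.
have -> : [set x | V x <= E] = `[- t', t]%classic.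
  apply/seteqP; split => x /=; rewrite in_itv /=.
    move=> VxE; apply/andP; split; rewrite leNgt; apply/negP => H.
      have H' : t' < - x by rewrite ltrNr.
      have := power_like_lt kappa_ge1 Vn t'0 H'.
      by rewrite opprK t'E ltNge VxE.
    by have := power_like_lt kappa_ge1 Vp t0 H; rewrite tE ltNge VxE.
  move=> /andP[tx xt]; have [x0|x0] := leP 0 x.
    by rewrite -tE; exact: (potential_le kappa_ge1 cV).
  rewrite -t'E -[x]opprK.
  have x0' : 0 <= - x by rewrite oppr_ge0 ltW.
  have xt' : - x <= t' by rewrite lerNl.
  exact: (potential_le kappa_ge1 (potential_class_opp cV) x0' xt').
rewrite lebesgue_measure_itv /= lte_fin (@lt_trans _ _ 0) ?oppr_lt0//.
by rewrite opprK.
Qed.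

Lemma sublevel_length_bounds V E t : potential_class kappa V ->
  0 < E -> 0 < t -> V t = E ->
  t <= sublevel_length V E <= (1 + kappa `^ kappa) * t.
Proof.
move=> cV E0 t0 tE.
have [t' t'0 t'E] := turning_point kappa_ge1 (potential_class_opp cV) E0.
rewrite (sublevel_length_eq cV t0 t'0 tE t'E) lerDl (ltW t'0) /= mulrDl mul1r.
by rewrite lerD2l; exact: (turning_points_comparable cV E0).
Qed.

Lemma turning_point_uncertainty V psi dpsi P E t :
  potential_class kappa V -> normalised_solution V E psi dpsi P ->
  0 < t -> V t = E -> (24 * (2 * kappa) `^ kappa)^-1 <= t * Num.sqrt E.
Proof.
move=> cV sol t0 tE.
have E0 := eigenvalue_gt0 cV sol.
(* Chosen so that [V >= 2 * E] at both [M * t] and [- (M * t)]: growth gains [2 * kappa] and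
   reflection loses [kappa]. *)
set M := (2 * kappa) `^ kappa.
have k2 : 1 <= 2 * kappa by rewrite -[leLHS]mulr1 ler_pM ?ler1n.
have M1 : 1 <= M by rewrite /M -[leLHS](powRr0 (2 * kappa)) ler_powR// ltW.
have M0 : 0 < M by exact: lt_le_trans M1.
have Mt0 : 0 < M * t by rewrite mulr_gt0.
have VM x : `|x| = M * t -> 2 * E <= V x.
  move=> xM; have tx : t <= `|x| by rewrite xM ler_peMl// ltW.
  have [+ _] := potential_norm_ge_growth cV t0 tx.
  rewrite xM mulfK ?gt_eqF// powR_kappaK ?mulr_ge0 ?(ltW kappa_gt0)// tE.
  by rewrite mulrCA mulVf ?gt_eqF// mulr1.
have VNM : 2 * E <= V (- (M * t)) by apply: VM; rewrite normrN gtr0_norm.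
have H := solution_uncertainty kappa_ge1 cV sol Mt0 (VM _ (gtr0_norm Mt0)) VNM.
have M24 : 0 < 24 * M by rewrite mulr_gt0.
rewrite -[leLHS]mul1r ler_pdivrMr//; lra.
Qed.

Lemma solution_density_exp_decay : exists c K : R, [/\ 0 < c, 0 < K &
  forall V psi dpsi P E t x,
    potential_class kappa V -> normalised_solution V E psi dpsi P ->
    0 < t -> V t = E -> 4 * E <= V x ->
    psi x ^+ 2 + dpsi x ^+ 2 / E <= K / t * expR (- (c * `|x| * Num.sqrt (V x)))].
Proof.
(* Dividing a positive argument by [m] at most halves [V]. Hence from [4 * E <= V x] one gets
   [V >= E] from [x / m ^ 2] on and [V - E >= V x / 4] on [[x / m, x]]; [l = sqrt m] places a third
   point [x / l] strictly between [x / m] and [x]. The rate [c = l^-1 - m^-1] is the relative length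
   on which the flux decays. *)
pose m : R := 2 `^ kappa^-1; pose l : R := m `^ 2^-1.
have m1 : 1 < m.
  rewrite /m -[ltLHS](one_powR kappa^-1) gt0_ltr_powR ?nnegrE ?invr_gt0//; lra.
have l1 : 1 < l.
  by rewrite /l -[ltLHS](one_powR 2^-1) gt0_ltr_powR ?nnegrE ?invr_gt0// ltW// (lt_trans ltr01).
have m0 : 0 < m by exact: lt_trans m1.
have l0 : 0 < l by exact: lt_trans l1.
have llm : l * l = m.
  by rewrite -expr2 -powR_mulrn ?(ltW l0)// /l -powRrM mulVf// powRr1// ltW.
have mk : m `^ kappa = 2 by rewrite /m powRK ?gt_eqF// .
have lm : l < m by rewrite -llm ltr_pMl.
pose c := l^-1 - m^-1.
have c0 : 0 < c by rewrite subr_gt0 ltf_pV2.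
have lV : l^-1 < 1 by rewrite invf_lt1.
have mV : m^-1 < 1 by rewrite invf_lt1.
pose M := 24 * (2 * kappa) `^ kappa.
have M0 : 0 < M by rewrite mulr_gt0// powR_gt0// mulr_gt0.
pose K0 := 2 * M / ((1 - l^-1) * (1 - m^-1)).
have lp : 0 < 1 - l^-1 by rewrite subr_gt0.
have mp : 0 < 1 - m^-1 by rewrite subr_gt0.
have K00 : 0 < K0 by apply: divr_gt0; apply: mulr_gt0.
have pos V psi dpsi P E t x : potential_class kappa V ->
    normalised_solution V E psi dpsi P -> 0 < t -> V t = E -> 4 * E <= V x -> 0 < x ->
    psi x ^+ 2 + dpsi x ^+ 2 / E <= K0 / t * expR (- (c * x * Num.sqrt (V x))).
  move=> cV sol t0 tE Vx x0; have [_ _ _ Vp _] := cV.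
  have E0 := eigenvalue_gt0 cV sol.
  have half u : 0 < u -> V u <= 2 * V (u / m).
    move=> u0; have um0 : 0 < u / m by rewrite divr_gt0.
    have um : u / m <= u by rewrite ler_pdivrMr// ler_peMr// ltW.
    have := power_like_upper Vp um0 um.
    by rewrite invf_div mulrCA mulfV ?gt_eqF// mulr1 mk.
  pose z := x / m; pose a := z / m; pose y := x / l.
  have z0 : 0 < z by rewrite divr_gt0.
  have a0 : 0 < a by rewrite divr_gt0.
  have Vz : V x <= 2 * V z := half x x0.
  have Va : V z <= 2 * V a := half z z0.
  have Vmono u v : 0 < u -> u <= v -> V u <= V v.
    by move=> u0; apply: (potential_le kappa_ge1 cV); exact: ltW.
  have ta : t <= a.
    rewrite leNgt; apply/negP => at_.
    by have := power_like_lt kappa_ge1 Vp a0 at_; rewrite tE; lra.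
  have az : a < z by rewrite /a ltr_pdivrMr// ltr_pMr.
  have zy : z <= y by rewrite /z /y ler_pM2l// lef_pV2 ?posrE// ltW.
  have yx : y < x by rewrite /y ltr_pdivrMr// ltr_pMr.
  have Vx0 : 0 < V x by rewrite (power_like_gt0 Vp).
  pose s := Num.sqrt (V x) / 2.
  have s0 : 0 < s by rewrite divr_gt0// sqrtr_gt0.
  have s2 : s ^+ 2 = V x / 4 by rewrite expr_div_n sqr_sqrtr ?ltW//; field.
  have EV u : a <= u -> E <= V u.
    by move=> au; apply: le_trans (Vmono _ _ a0 au); lra.
  apply: le_trans (solution_density_decay kappa_ge1 cV sol EV az zy yx s0 _ _) _.
  - by rewrite s2; lra.
  - by move=> u /andP[zu _]; have := Vmono _ _ z0 zu; rewrite s2; lra.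
  have -> : 2 * s * (y - z) = c * x * Num.sqrt (V x).
    by rewrite /s /c /y /z; field; rewrite !gt_eqF.
  rewrite ler_wpM2r ?expR_ge0//.
  (* Both gaps [x - y] and [z - a] are multiples of [t]; the uncertainty bound [sqrt E * t >= M^-1]
     absorbs one of the two factors [t] together with [sqrt E]. *)
  have unc := turning_point_uncertainty cV sol t0 tE; rewrite -/M in unc.
  have xy : t * (1 - l^-1) <= x - y.
    have -> : x - y = x * (1 - l^-1) by rewrite /y; ring.
    rewrite ler_wpM2r ?subr_ge0 ?(ltW lV)//; lra.
  have za : t * (1 - m^-1) <= z - a.
    have -> : z - a = z * (1 - m^-1) by rewrite /a; ring.
    rewrite ler_wpM2r ?subr_ge0 ?(ltW mV)//; lra.
  have sE : 0 < Num.sqrt E by rewrite sqrtr_gt0.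
  have -> : K0 / t = 2 / (M^-1 * t * ((1 - l^-1) * (1 - m^-1))).
    by rewrite /K0; field; rewrite !gt_eqF//; lra.
  rewrite ler_pM2l// lef_pV2 ?posrE ?mulr_gt0 ?invr_gt0 ?subr_gt0//.
  apply: (@le_trans _ _ (Num.sqrt E * (t * (1 - l^-1)) * (t * (1 - m^-1)))).
    have -> : Num.sqrt E * (t * (1 - l^-1)) * (t * (1 - m^-1)) =
      (t * Num.sqrt E) * t * ((1 - l^-1) * (1 - m^-1)) by ring.
    by rewrite ler_wpM2r ?mulr_ge0 ?(ltW lp) ?(ltW mp)// ler_wpM2r// ltW.
  have xy0 : 0 <= t * (1 - l^-1) by rewrite mulr_ge0 ?ltW.
  have za0 : 0 <= t * (1 - m^-1) by rewrite mulr_ge0 ?ltW.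
  apply: ler_pM => //; first by rewrite mulr_ge0// ltW.
  by apply: ler_wpM2l => //; exact: ltW.
exists c, (K0 * kappa `^ kappa); split => //; first by rewrite mulr_gt0// powR_gt0.
have k1 : 1 <= kappa `^ kappa by rewrite -[leLHS](powRr0 kappa) ler_powR// ltW.
move=> V psi dpsi P E t x cV sol t0 tE Vx.
have E0 := eigenvalue_gt0 cV sol.
have [x0|x0|x0] := ltgtP 0 x.
- rewrite gtr0_norm//; apply: le_trans (pos _ _ _ _ _ _ _ cV sol t0 tE Vx x0) _.
  rewrite ler_wpM2r ?expR_ge0// ler_wpM2r ?invr_ge0 ?(ltW t0)//.
  by rewrite ler_peMr// ltW.
(* Reflection produces the bound with the left turning point [t']; returning to [t] costs the factor
   [kappa ^ kappa]. *)
- have cVN := potential_class_opp cV.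
  have [t' t'0 t'E] := turning_point kappa_ge1 cVN E0.
  have nx : 0 < - x by rewrite oppr_gt0.
  have Vx' : 4 * E <= V (- - x) by rewrite opprK.
  have := pos _ _ _ _ _ _ _ cVN (normalised_solution_reflect sol) t'0 t'E Vx' nx.
  rewrite !opprK sqrrN ltr0_norm// => /le_trans; apply.
  rewrite ler_wpM2r ?expR_ge0// -mulrA ler_pM2l//.
  rewrite ler_pdivlMr// ler_pdivrMl//.
  have tE' : V (- - t) = E by rewrite opprK.
  by rewrite mulrC; exact: (turning_points_comparable cVN E0 t'0 t0 t'E tE').
- by have [_ V0 _ _ _] := cV; move: Vx; rewrite -x0 V0; lra.
Qed.

End Geometry.

(** * Weighted estimates *)

Section WeightedEstimates.
Context {R : realType} (kappa : R) (kappa_ge1 : 1 <= kappa).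
Implicit Types (V W psi dpsi P : R -> R) (a b E x y z t u r m : R).
Local Notation mu := (@lebesgue_measure R).

Let kappa_gt0 : 0 < kappa := lt_le_trans ltr01 kappa_ge1.

Lemma powR_ge1_le x y r : 1 <= x -> x <= y -> x `^ r <= y `^ `|r|.
Proof.
move=> x1 xy; apply: (@le_trans _ _ (x `^ `|r|)).
  by rewrite ler_powR// ler_norm.
by rewrite ge0_ler_powR ?nnegrE// (le_trans ler01)// (le_trans x1).
Qed.

(** A single term of the exponential series, of integer order at least [|m|], already dominates the
    power. *)
Lemma powR_le_expR m (d : R) : 0 < d ->
  exists2 K, 0 < K & forall s : R, 1 <= s -> s `^ m <= K * expR (d * s).
Proof.
move=> d0; pose n := Num.trunc `|m|.
have fn : (0 : R) < (n.+1)`!%:R by rewrite ltr0n fact_gt0.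
have dn : 0 < d ^+ n.+1 by rewrite exprn_gt0.
exists ((n.+1)`!%:R / d ^+ n.+1); first by rewrite divr_gt0.
move=> s s1; have s0 : 0 <= s by exact: le_trans s1.
apply: (@le_trans _ _ (s ^+ n.+1)).
  rewrite -powR_mulrn// ler_powR// (le_trans (ler_norm m))//.
  exact/ltW/truncnS_gt.
rewrite mulrAC ler_pdivlMr// mulrC -exprMn mulrC -ler_pdivrMl// mulrC.
apply: le_trans (expR_ge1Dxn n _); last by rewrite mulr_ge0// ltW.
by rewrite [leLHS]mulrC lerDr ler01.
Qed.

(** As [b] may have either sign, [V x / E] is bounded on both sides. Dividing it by its lower bound
    [v0] gives a ratio at least 1, whose [b]-th power is at most the [|b|]-th power of the upper
    bound. Starting from [th * t] instead of [t] covers everything outside the inner interval. *)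
Lemma weight_growth a b (th : R) : 0 < th -> th <= 1 ->
  exists K m, [/\ 0 < K, 0 <= m & forall V E t x,
    potential_class kappa V -> 0 < E -> 0 < t -> V t = E -> th * t <= `|x| ->
    `|x| `^ a * V x `^ b <= K * (`|x| / (th * t)) `^ m * (t `^ a * E `^ b)].
Proof.
move=> th0 th1.
(* One factor [kappa^-1] is lost between [V t] and [V (th * t)], another between [V (th * t)] and
   [V x]. *)
pose v0 := kappa ^- 2 * th `^ kappa.
have k20 : 0 < kappa ^+ 2 by rewrite exprn_gt0.
have v00 : 0 < v0 by rewrite mulr_gt0 ?powR_gt0// invr_gt0.
exists (th `^ a * v0 `^ b * (kappa ^+ 2 / v0) `^ `|b|), (`|a| + kappa * `|b|).
split.
- by rewrite !mulr_gt0 ?powR_gt0// divr_gt0.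
- by rewrite addr_ge0// mulr_ge0// ltW.
move=> V E t x cV E0 t0 tE; set r := th * t => rx.
have r0 : 0 < r by rewrite mulr_gt0.
set s := `|x| / r.
have s1 : 1 <= s by rewrite ler_pdivlMr// mul1r.
have s0 : 0 < s by exact: lt_le_trans s1.
have xE : `|x| = s * th * t by rewrite -mulrA divfK// gt_eqF.
have [Vr_lo Vr_up] : kappa^-1 * th `^ kappa * E <= V r /\ V r <= kappa * E.
  have rt : `|r| <= t by rewrite gtr0_norm// ger_pMl.
  have [+ +] := potential_norm_le_decay kappa_ge1 cV (lt0r_neq0 r0) rt.
  rewrite gtr0_norm// mulfK ?gt_eqF// tE => lo up; split => //.
  apply: le_trans up _; rewrite ler_pM2r// ger_pMr//.
  rewrite -[leRHS](one_powR kappa^-1).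
  by rewrite ge0_ler_powR ?nnegrE ?invr_ge0 ?(ltW kappa_gt0) ?(ltW th0) ?ler01.
have [Vx_lo Vx_up] : V r * kappa^-1 <= V x /\ V x <= kappa * s `^ kappa * V r.
  have [lo up] := potential_norm_ge_growth kappa_ge1 cV r0 rx; split => //.
  apply: le_trans lo; rewrite mulrC ler_pM2r ?(potential_gt0 cV) ?gt_eqF//.
  rewrite ler_peMr ?invr_ge0 ?(ltW kappa_gt0)//.
  by rewrite -[leLHS](powRr0 s) ler_powR// invr_ge0 ltW.
have vlo : v0 <= V x / E.
  rewrite ler_pdivlMr//; apply: le_trans Vx_lo.
  rewrite ler_pdivlMr//; apply: le_trans Vr_lo.
  by rewrite le_eqVlt; apply/orP; left; apply/eqP; rewrite /v0; field; rewrite gt_eqF.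
have vup : V x / E <= kappa ^+ 2 * s `^ kappa.
  rewrite ler_pdivrMr//; apply: le_trans Vx_up _.
  have : kappa * s `^ kappa * V r <= kappa * s `^ kappa * (kappa * E).
    by rewrite ler_wpM2l// mulr_ge0 ?powR_ge0// ltW.
  by move/le_trans; apply; rewrite le_eqVlt; apply/orP; left; apply/eqP; ring.
have w1 : 1 <= V x / E / v0 by rewrite ler_pdivlMr// mul1r.
have w0 : 0 < V x / E / v0 by exact: lt_le_trans w1.
have w2 : V x / E / v0 <= kappa ^+ 2 / v0 * s `^ kappa.
  by rewrite [leRHS]mulrAC ler_pM2r ?invr_gt0.
have -> : V x `^ b = v0 `^ b * (V x / E / v0) `^ b * E `^ b.
  have ve : V x = v0 * (V x / E / v0) * E by field; rewrite !gt_eqF.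
  rewrite {1}ve; set w := V x / E / v0 in w0 *.
  have vw : 0 <= v0 * w by rewrite mulr_ge0// ltW.
  by rewrite (powRM b vw (ltW E0)) (powRM b (ltW v00) (ltW w0)).
have -> : `|x| `^ a = s `^ a * th `^ a * t `^ a.
  have st : 0 <= s * th by rewrite mulr_ge0// ltW.
  by rewrite xE (powRM a st (ltW t0)) (powRM a (ltW s0) (ltW th0)).
have -> : s `^ (`|a| + kappa * `|b|) = s `^ `|a| * (s `^ kappa) `^ `|b|.
  by rewrite powRD ?(gt_eqF s0) ?implybT// powRrM.
have sa := powR_ge1_le a s1 (lexx s).
have wb := powR_ge1_le b w1 w2.
rewrite [leRHS]powRM ?powR_ge0 ?divr_ge0 ?(ltW k20) ?(ltW v00)// in wb.
set A := s `^ a in sa *; set B := (V x / E / v0) `^ b in wb *.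
have : A * B <= s `^ `|a| * ((kappa ^+ 2 / v0) `^ `|b| * (s `^ kappa) `^ `|b|).
  by apply: ler_pM => //; exact: powR_ge0.
have c0 : 0 <= th `^ a * v0 `^ b * t `^ a * E `^ b by rewrite !mulr_ge0 ?powR_ge0.
move=> /(ler_wpM2l c0); lra.
Qed.

Lemma eigenfunction_decay : exists c K : R, [/\ 0 < c, 0 < K &
  forall V, potential_class kappa V -> forall E psi dpsi P,
    normalised_solution V E psi dpsi P -> forall x, 4 * E <= V x ->
    psi x ^+ 2 + dpsi x ^+ 2 / E <= K * ((sublevel_length V E)^-1
                  * expR (- (c * `|x| * Num.sqrt (V x))))].
Proof.
have [c [K [c0 K0 decay]]] := solution_density_exp_decay kappa_ge1.
have k0 : 0 < 1 + kappa `^ kappa by rewrite ltr_wpDr// powR_ge0.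
exists c, (K * (1 + kappa `^ kappa)); split => //; first exact: mulr_gt0.
move=> V cV E psi dpsi P sol x Vx.
have E0 := eigenvalue_gt0 cV sol.
have [t t0 tE] := turning_point kappa_ge1 cV E0.
have /andP[tL Lt] := sublevel_length_bounds kappa_ge1 cV E0 t0 tE.
have L0 : 0 < sublevel_length V E by exact: lt_le_trans tL.
apply: le_trans (decay _ _ _ _ _ _ _ cV sol t0 tE Vx) _.
rewrite mulrA ler_wpM2r ?expR_ge0// -mulrA ler_pM2l//.
by rewrite ler_pdivlMr// ler_pdivrMl// mulrC.
Qed.

(** A single integrable majorant for the whole outer region. Its terms are the mass density, the
    energy density over [E] and a Cauchy density that will dominate the exponential tail; their
    integrals are at most 1, 1 and [pi], the last one through [atan]. *)
Lemma solution_majorant V E psi dpsi P t : potential_class kappa V ->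
  normalised_solution V E psi dpsi P -> 0 < t ->
  let p x := psi x ^+ 2 + (dpsi x ^+ 2 + V x * psi x ^+ 2) / E +
             t^-1 / (1 + (x / t) ^+ 2) in
  continuous p /\ (\int[mu]_x (p x)%:E <= (2 + pi)%:E)%E.
Proof.
move=> cV sol t0 p; have E0 := eigenvalue_gt0 cV sol.
have V0 u : 0 <= V u by case: cV.
have [_ DE] := solution_energy_le kappa_ge1 cV sol.
have [d1 d2 dP P1 _] := sol.
have df u : is_derive u 1 (fun z => psi z ^+ 2) (2 * psi u * dpsi u).
  have i1 := d1 u; under eq_fun do rewrite expr2.
  by apply: is_derive_eq; rewrite -?[_ *: _]/(_ * _); ring.
have dd u : is_derive u 1 (fun z => dpsi z ^+ 2) (2 * (V u - E) * psi u * dpsi u).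
  have i1 := d2 u; under eq_fun do rewrite expr2.
  by apply: is_derive_eq; rewrite -?[_ *: _]/(_ * _); ring.
have den u : 0 < 1 + (u / t) ^+ 2 by rewrite ltr_wpDr// sqr_ge0.
have dlin u : is_derive u 1 (fun z : R => z / t) t^-1.
  by apply: is_derive_eq; rewrite -?[_ *: _]/(_ * _); ring.
have dat u : is_derive u 1 (fun z => atan (z / t)) (t^-1 / (1 + (u / t) ^+ 2)).
  have i1 := dlin u; rewrite mulrC.
  exact: (@is_derive1_comp R atan (fun z => z / t)).
have cf u : {for u, continuous (fun z => psi z ^+ 2)} := is_derive_continuous (df u).
have cp : continuous p.
  move=> u; apply: (@continuousD _ _ _
    (fun x => psi x ^+ 2 + (dpsi x ^+ 2 + V x * psi x ^+ 2) / E)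
    (fun x => t^-1 / (1 + (x / t) ^+ 2))).
    apply: (@continuousD _ _ _ (fun x => psi x ^+ 2)
      (fun x => (dpsi x ^+ 2 + V x * psi x ^+ 2) / E)) => //.
    apply: (@continuousM _ _ (fun x => dpsi x ^+ 2 + V x * psi x ^+ 2) (fun=> E^-1));
      last exact: cst_continuous.
    apply: (@continuousD _ _ _ (fun x => dpsi x ^+ 2) (fun x => V x * psi x ^+ 2)).
      exact: is_derive_continuous (dd u).
    apply: (@continuousM _ _ V (fun x => psi x ^+ 2)) => //.
    exact: (potential_continuous kappa_ge1 cV).
  apply: (@continuousM _ _ (fun=> t^-1) (fun x => (1 + (x / t) ^+ 2)^-1)).
    exact: cst_continuous.
  apply: (@continuousV _ _ (fun x => 1 + (x / t) ^+ 2)); first by rewrite gt_eqF.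
  apply: (@continuousD _ _ _ (fun=> (1 : R)) (fun x => (x / t) ^+ 2)).
    exact: cst_continuous.
  have cl := is_derive_continuous (dlin u).
  exact: (@continuousM _ _ (fun x => x / t) (fun x => x / t)).
split => //.
apply: (@ge0_integralT_primitive_le _ p
  (fun x => P x + (psi x * dpsi x + E * P x) / E + atan (x / t))) => //.
- move=> u; apply: addr_ge0; last first.
    by apply: divr_ge0; [rewrite invr_ge0 ltW|exact: ltW].
  apply: addr_ge0; first exact: sqr_ge0.
  apply: divr_ge0; last exact: ltW.
  by apply: addr_ge0; [exact: sqr_ge0|apply: mulr_ge0 => //; exact: sqr_ge0].
- move=> u; have i1 := d1 u; have i2 := d2 u; have i3 := dP u; have i4 := dat u.
  rewrite /p; apply: is_derive_eq; rewrite -?[_ *: _]/(_ * _).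
  by set q := _ / (1 + _); field; rewrite gt_eqF.
- move=> x y xy; have Pxy := P1 _ _ xy; have Dxy := DE x y.
  have : (psi y * dpsi y + E * P y - (psi x * dpsi x + E * P x)) / E <= 1.
    by rewrite ler_pdivrMr// mul1r.
  rewrite mulrBl; have := atan_ltpi2 (y / t); have := atan_gtNpi2 (x / t); lra.
Qed.

End WeightedEstimates.

Section WeightedIntegral.
Context {R : realType} (kappa : R) (kappa_ge1 : 1 <= kappa).
Implicit Types (V W psi dpsi P : R -> R) (a b E x y z t u r m : R).
Local Notation mu := (@lebesgue_measure R).

Let kappa_gt0 : 0 < kappa := lt_le_trans ltr01 kappa_ge1.

(* With [th = (4 kappa) ^ - kappa], the potential is at most [E / 4] on
   [`|x| <= th * t], and [V x < 4 * E] forces [`|x| <= t / th]. *)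
Lemma weighted_density_outer a b : let th := (4 * kappa) `^ (- kappa) in
  exists2 K : R, 0 < K & forall V W psi dpsi P E t C x,
    potential_class kappa V -> normalised_solution V E psi dpsi P ->
    0 < t -> V t = E -> th * t <= `|x| ->
    0 < C -> 0 <= W x -> W x <= C * `|x| `^ a * V x `^ b ->
    W x * (psi x ^+ 2 + dpsi x ^+ 2 / E) <=
      C * (t `^ a * E `^ b) * K *
      (psi x ^+ 2 + (dpsi x ^+ 2 + V x * psi x ^+ 2) / E +
             t^-1 / (1 + (x / t) ^+ 2)).
Proof.
move=> th.
have k4 : 1 <= 4 * kappa by rewrite -[leLHS]mulr1 ler_pM ?ler1n.
have k40 : 0 < 4 * kappa by exact: lt_le_trans k4.
have th0 : 0 < th by rewrite powR_gt0.
have thV : th^-1 = (4 * kappa) `^ kappa by rewrite /th powRN invrK.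
have th1 : th <= 1.
  rewrite -(invrK th) invf_le1 ?invr_gt0// thV.
  by rewrite -[leLHS](powRr0 (4 * kappa)) ler_powR// ltW.
have [K1 [m [K10 m0 growth]]] := weight_growth kappa_ge1 a b th0 th1.
have [c [Kd [c0 Kd0 decay]]] := solution_density_exp_decay kappa_ge1.
pose c1 := (24 * (2 * kappa) `^ kappa)^-1.
have c10 : 0 < c1 by rewrite invr_gt0 mulr_gt0// powR_gt0// mulr_gt0.
(* With [s = |x| / (th * t)], the bounds [sqrt (V x) >= sqrt E >= c1 / t] give
   [c * |x| * sqrt (V x) >= d * s]. *)
pose d := c * th * c1.
have d0 : 0 < d by rewrite !mulr_gt0.
(* The two extra powers leave a factor [s ^ - 2], comparable to the Cauchy density. *)
have [K2 K20 HK2] := powR_le_expR (m + 2) d0.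
pose S := th^-1 / th.
have S0 : 0 < S by rewrite divr_gt0 ?invr_gt0.
exists (K1 * (S `^ m + 2 * Kd * K2)).
  by rewrite mulr_gt0// addr_gt0 ?powR_gt0// !mulr_gt0.
move=> V W psi dpsi P E t C x cV sol t0 tE rx C0 W0 Wx.
have E0 := eigenvalue_gt0 cV sol.
have V0 u : 0 <= V u by case: cV.
have gr := growth V E t x cV E0 t0 tE rx.
set r := th * t in rx gr; have r0 : 0 < r by rewrite mulr_gt0.
set s := `|x| / r in gr.
have s1 : 1 <= s by rewrite ler_pdivlMr// mul1r.
have s0 : 0 < s by exact: lt_le_trans s1.
set T := t `^ a * E `^ b in gr *.
have T0 : 0 <= T by rewrite mulr_ge0 ?powR_ge0.
set f := psi x ^+ 2; set g := dpsi x ^+ 2.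
have f0 : 0 <= f by exact: sqr_ge0.
have g0 : 0 <= g / E by rewrite divr_ge0 ?sqr_ge0 ?(ltW E0).
have Vf : 0 <= V x * f / E by apply: divr_ge0; [exact: mulr_ge0|exact: ltW].
set q := t^-1 / (1 + (x / t) ^+ 2).
have den : 0 < 1 + (x / t) ^+ 2 by rewrite ltr_wpDr ?sqr_ge0.
have q0 : 0 <= q by apply: divr_ge0; [rewrite invr_ge0|]; exact: ltW.
have {}Wx : W x <= C * (K1 * s `^ m * T).
  by apply: le_trans Wx _; rewrite -mulrA ler_pM2l.
have CT0 : 0 <= C * T * K1.
  by apply: mulr_ge0; [apply: mulr_ge0 => //|]; exact: ltW.
have main : s `^ m * (f + g / E) <= (S `^ m + 2 * Kd * K2) * (f + (g + V x * f) / E + q).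
  have S0' := powR_gt0 m S0.
  have KK0 : 0 < 2 * Kd * K2 by apply: mulr_gt0 => //; apply: mulr_gt0.
  (* Below [4 * E] one has [s <= th ^ - 2 = S], and the density is bounded by the mass and energy
     terms of the majorant. Above it, the exponential decay is absorbed by the Cauchy term [q]. *)
  have [Vx|Vx] := ltP (V x) (4 * E).
    have sS : s `^ m <= S `^ m.
      rewrite ge0_ler_powR ?nnegrE ?(ltW s0) ?(ltW S0)//.
      have -> : s = `|x| / t / th by rewrite /s /r; field; rewrite !gt_eqF.
      rewrite ler_pM2r ?invr_gt0//.
      have [tx|xt] := leP t `|x|; last first.
        apply: (@le_trans _ _ 1); first by rewrite ler_pdivrMr// mul1r ltW.
        by rewrite -(invrK 1) lef_pV2 ?posrE ?invr1.
      have [lo _] := potential_norm_ge_growth kappa_ge1 cV t0 tx.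
      rewrite tE in lo.
      have : (`|x| / t) `^ kappa^-1 <= 4 * kappa.
        have := le_lt_trans lo Vx; rewrite ltr_pM2r// ltr_pdivrMl// => /ltW.
        by rewrite [kappa * 4]mulrC.
      have xt0 : 0 <= `|x| / t by rewrite divr_ge0// ltW.
      move=> H; rewrite thV -[leLHS](powRK (lt0r_neq0 kappa_gt0) xt0).
      by rewrite ge0_ler_powR ?nnegrE ?powR_ge0 ?(ltW k40) ?(ltW kappa_gt0).
    apply: ler_pM; [exact: powR_ge0|exact: addr_ge0| |by rewrite mulrDl; lra].
    by apply: le_trans sS _; rewrite lerDl; exact: ltW.
  have dx := decay V psi dpsi P E t x cV sol t0 tE Vx; rewrite -/f -/g in dx.
  have ex : expR (- (c * `|x| * Num.sqrt (V x))) <= expR (- (d * s)).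
    rewrite ler_expR lerN2.
    have -> : d * s = c * `|x| * (c1 / t).
      by rewrite /d /s /r; field; rewrite !gt_eqF.
    rewrite ler_wpM2l ?mulr_ge0 ?(ltW c0)//.
    rewrite ler_pdivrMr//; apply: le_trans (turning_point_uncertainty kappa_ge1 cV sol t0 tE) _.
    by rewrite mulrC ler_pM2r// ler_wsqrtr//; lra.
  have sm : s `^ m * expR (- (d * s)) <= K2 / s ^+ 2.
    rewrite expRN ler_pdivrMr ?expR_gt0// mulrAC ler_pdivlMr ?exprn_gt0//.
    rewrite -powR_mulrn ?(ltW s0)// -powRD ?(gt_eqF s0) ?implybT//.
    exact: HK2.
  have sq : (s ^+ 2)^-1 <= 2 / (1 + (x / t) ^+ 2).
    rewrite ler_pdivlMr// ler_pdivrMl ?exprn_gt0//.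
    have -> : (x / t) ^+ 2 = (th * s) ^+ 2.
      rewrite -(real_normK (num_real (x / t))) normrM (@ger0_norm _ t^-1) ?invr_ge0 ?(ltW t0)//.
      by congr (_ ^+ 2); rewrite /s /r; field; rewrite !gt_eqF.
    have : (th * s) ^+ 2 <= s ^+ 2.
      have ths : th * s <= s by rewrite ger_pMl.
      by apply: lerXn2r => //; rewrite nnegrE; [apply: mulr_ge0|]; exact: ltW.
    have : 1 <= s ^+ 2 by exact: exprn_ege1.
    lra.
  apply: (@le_trans _ _ (2 * Kd * K2 * q)).
    apply: (@le_trans _ _ (s `^ m * (Kd / t * expR (- (d * s))))).
      rewrite ler_wpM2l ?powR_ge0//; apply: le_trans dx _.
      by rewrite ler_wpM2l// divr_ge0 ?(ltW Kd0) ?(ltW t0).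
    rewrite mulrCA.
    apply: (@le_trans _ _ (Kd / t * (K2 * (2 / (1 + (x / t) ^+ 2))))).
      rewrite ler_wpM2l ?divr_ge0 ?(ltW Kd0) ?(ltW t0)//.
      by apply: le_trans sm _; rewrite ler_wpM2l ?(ltW K20).
    by rewrite /q le_eqVlt; apply/orP; left; apply/eqP; ring.
  apply: ler_pM => //; [exact: ltW|by rewrite lerDr ltW|by rewrite mulrDl; lra].
apply: (@le_trans _ _ (C * (K1 * s `^ m * T) * (f + g / E))).
  by rewrite ler_wpM2r ?addr_ge0.
have := ler_wpM2l CT0 main; lra.
Qed.

Lemma eigenfunction_weighted_integral a b : exists2 K : R, 0 < K &
  forall V, potential_class kappa V ->
  forall W (C : R), measurable_fun [set: R] W -> (forall x, 0 <= W x) -> 0 < C ->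
  weight_bound V W a b C ->
  forall E psi dpsi P, normalised_solution V E psi dpsi P ->
  (\int[mu]_x (W x * (psi x ^+ 2 + dpsi x ^+ 2 / E))%:E
     <= (K * (C * sublevel_length V E `^ a * E `^ b))%:E)%E.
Proof.
pose th := (4 * kappa) `^ (- kappa).
have k4 : 1 <= 4 * kappa by rewrite -[leLHS]mulr1 ler_pM ?ler1n.
have k40 : 0 < 4 * kappa by exact: lt_le_trans k4.
have th0 : 0 < th by rewrite powR_gt0.
have thV : th^-1 = (4 * kappa) `^ kappa by rewrite /th powRN invrK.
have th1 : th <= 1.
  rewrite -(invrK th) invf_le1 ?invr_gt0// thV.
  by rewrite -[leLHS](powRr0 (4 * kappa)) ler_powR// ltW.
have [K3 K30 outer] := weighted_density_outer a b; rewrite -/th in outer.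
have [K1 [m [K10 m0 growth]]] := weight_growth kappa_ge1 a b th0 th1.
pose B := 1 + kappa `^ kappa.
have B0 : 0 < B by rewrite ltr_wpDr// powR_ge0.
(* The first summand is for the inner interval, where the density is at most [8 / r]; the second is
   for the outer majorant. *)
pose K4 := 8 * K1 + K3 * (2 + pi).
have K40 : 0 < K4.
  by apply: addr_gt0; apply: mulr_gt0 => //; apply: addr_gt0 => //; exact: pi_gt0.
exists (K4 * B `^ `|a|); first by rewrite mulr_gt0 ?powR_gt0.
move=> V cV W C mW W0 C0 WB E psi dpsi P sol.
have E0 := eigenvalue_gt0 cV sol.
have V0 u : 0 <= V u by case: cV.
have [t t0 tE] := turning_point kappa_ge1 cV E0.
have /andP[tL Lt] := sublevel_length_bounds kappa_ge1 cV E0 t0 tE.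
set L := sublevel_length V E in tL Lt *.
have L0 : 0 < L by exact: lt_le_trans tL.
set T := t `^ a * E `^ b.
have T0 : 0 <= T by rewrite mulr_ge0 ?powR_ge0.
(* Since [t <= L <= B * t], exchanging [t] for [L] costs at most [B ^ |a|], whatever the sign of
   [a]. *)
have TL : T <= B `^ `|a| * (L `^ a * E `^ b).
  rewrite mulrA ler_wpM2r ?powR_ge0//.
  have Lt1 : 1 <= L / t by rewrite ler_pdivlMr// mul1r.
  have LtB : L / t <= B by rewrite ler_pdivrMr.
  have := powR_ge1_le (- a) Lt1 LtB.
  rewrite normrN powRN powR_div// invf_div ler_pdivrMr ?powR_gt0//.
suff : (\int[mu]_x (W x * (psi x ^+ 2 + dpsi x ^+ 2 / E))%:E <= (C * T * K4)%:E)%E.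
  move/le_trans; apply; rewrite lee_fin.
  have CK : 0 <= C * K4 by apply: mulr_ge0; exact: ltW.
  by have := ler_wpM2l CK TL; lra.
set r := th * t; have r0 : 0 < r by rewrite mulr_gt0.
pose dens x := psi x ^+ 2 + dpsi x ^+ 2 / E.
have dens0 x : 0 <= dens x.
  by rewrite addr_ge0 ?sqr_ge0// divr_ge0 ?sqr_ge0// ltW.
have [d1 d2 _ _ _] := sol.
have mdens : measurable_fun [set: R] dens.
  have m1 : measurable_fun [set: R] psi.
    by apply: continuous_measurable_fun => u; exact: is_derive_continuous (d1 u).
  have m2 : measurable_fun [set: R] dpsi.
    by apply: continuous_measurable_fun => u; exact: is_derive_continuous (d2 u).
  apply: measurable_funD; first exact: measurable_funX.
  by apply: measurable_funM => //; exact: measurable_funX.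
have mWd : measurable_fun [set: R] (fun x => W x * dens x) by exact: measurable_funM.
pose A := `[(- r)%R, r]%classic : set R.
have mA : measurable A by exact: measurable_itv.
have -> : (\int[mu]_x (W x * (psi x ^+ 2 + dpsi x ^+ 2 / E))%:E =
  \int[mu]_(x in A) (W x * dens x)%:E + \int[mu]_(x in ~` A) (W x * dens x)%:E)%E.
  rewrite -ge0_integral_setU//.
  - by rewrite setUv.
  - exact: measurableC.
  - by rewrite setUv; apply/measurable_EFinP.
  - by move=> x _; rewrite lee_fin mulr_ge0.
  - by apply/disj_setPS; rewrite setICr.
have inner : (\int[mu]_(x in A) (W x * dens x)%:E <= (C * T * (8 * K1))%:E)%E.
  have Vr4 x : `|x| = r -> V x <= E / 4.
    move=> xr; have x0 : x != 0 by rewrite -normr_gt0 xr.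
    have xt : `|x| <= t by rewrite xr ger_pMl.
    have [_] := potential_norm_le_decay kappa_ge1 cV x0 xt.
    rewrite xr mulfK ?gt_eqF// tE /th.
    rewrite -powRrM mulNr mulfV ?gt_eqF// powR_inv1 ?(ltW k40)//.
    have -> : kappa * (4 * kappa)^-1 * E = E / 4 by field; rewrite gt_eqF.
    by [].
  apply: (@le_trans _ _ (\int[mu]_(x in A) ((8 / r)%:E * (W x)%:E))%E).
    apply: ge0_le_integral => //.
    - by move=> x _; rewrite lee_fin mulr_ge0.
    - by apply: measurable_funTS; apply/measurable_EFinP.
    - by apply: measurable_funTS; apply: measurable_funeM; apply/measurable_EFinP.
    - move=> x; rewrite /A /= in_itv /= -ler_norml => xr.
      rewrite -EFinM lee_fin mulrC ler_wpM2r//.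
      apply: (solution_density_inner kappa_ge1 cV sol r0) => //; apply: Vr4.
        exact: gtr0_norm.
      by rewrite normrN gtr0_norm.
  rewrite ge0_integralZl_EFin//; last 3 first.
  - by move=> x _; rewrite lee_fin.
  - by apply: measurable_funTS; apply/measurable_EFinP.
  - by rewrite divr_ge0// ltW.
  have [_] := WB r (lt0r_neq0 r0); rewrite gtr0_norm// -/A => intW.
  apply: (@le_trans _ _ ((8 / r)%:E * (C * r `^ (a + 1) * V r `^ b)%:E)%E).
    by apply: lee_wpmul2l => //; rewrite lee_fin divr_ge0// ltW.
  rewrite -EFinM lee_fin.
  (* The growth estimate at its left end, where the ratio is 1, compares [r ^ a * V r ^ b] with
     [t ^ a * E ^ b]. *)
  have rr : th * t <= `|r| by rewrite gtr0_norm.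
  have := growth V E t r cV E0 t0 tE rr.
  rewrite gtr0_norm// -/r divff ?gt_eqF// one_powR mulr1 -/T => gr.
  rewrite powRD ?(gt_eqF r0) ?implybT// powRr1 ?(ltW r0)//.
  have -> : 8 / r * (C * (r `^ a * r) * V r `^ b) = 8 * C * (r `^ a * V r `^ b).
    by field; rewrite gt_eqF.
  have C8 : 0 <= 8 * C by rewrite mulr_ge0// ltW.
  by have := ler_wpM2l C8 gr; lra.
have [cp intp] := solution_majorant kappa_ge1 cV sol t0.
set p := (fun x => _) in cp intp.
have p0 x : 0 <= p x.
  apply: addr_ge0; last first.
    apply: divr_ge0; first by rewrite invr_ge0 ltW.
    by apply: addr_ge0 => //; exact: sqr_ge0.
  apply: addr_ge0; first exact: sqr_ge0.
  apply: divr_ge0; last exact: ltW.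
  by apply: addr_ge0; [exact: sqr_ge0|apply: mulr_ge0 => //; exact: sqr_ge0].
have CTK : 0 <= C * T * K3.
  by apply: mulr_ge0; [apply: mulr_ge0 => //|]; exact: ltW.
have mp : measurable_fun [set: R] (fun x => (p x)%:E).
  by apply/measurable_EFinP; exact: continuous_measurable_fun.
have outerI : (\int[mu]_(x in ~` A) (W x * dens x)%:E <= (C * T * (K3 * (2 + pi)))%:E)%E.
  apply: (@le_trans _ _ (\int[mu]_(x in ~` A) ((C * T * K3)%:E * (p x)%:E))%E).
    apply: ge0_le_integral.
    - exact: measurableC.
    - by move=> x _; rewrite lee_fin mulr_ge0.
    - by apply: measurable_funTS; apply/measurable_EFinP.
    - by apply: measurable_funTS; exact: measurable_funeM.
    - move=> x; rewrite /A /= in_itv /= -ler_norml => /negP; rewrite -ltNge => rx.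
      have x0 : x != 0 by rewrite -normr_gt0 (lt_trans r0).
      rewrite -EFinM lee_fin; apply: (outer V W psi dpsi P) => //; first exact: ltW.
      by have [] := WB x x0.
  apply: (@le_trans _ _ (\int[mu]_x ((C * T * K3)%:E * (p x)%:E))%E).
    apply: ge0_subset_integral => //; first exact: measurableC.
      by apply: measurable_funeM.
    by move=> x _; rewrite -EFinM lee_fin mulr_ge0.
  rewrite ge0_integralZl_EFin//; last by move=> x _; rewrite lee_fin.
  have -> : C * T * (K3 * (2 + pi)) = C * T * K3 * (2 + pi) by ring.
  by rewrite [X in (_ <= X)%E]EFinM; apply: lee_wpmul2l => //; rewrite lee_fin.
apply: le_trans (leeD inner outerI) _.
by rewrite -EFinD lee_fin /K4; lra.
Qed.

End WeightedIntegral.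

(** * Power weights: integrability at the origin and the weight condition *)

Section PowerWeights.
Context {R : realType} (kappa : R) (kappa_ge1 : 1 <= kappa).
Implicit Types (V W : R -> R) (a b g x y t X : R).
Local Notation mu := (@lebesgue_measure R).

Let kappa_gt0 : 0 < kappa := lt_le_trans ltr01 kappa_ge1.

Lemma continuous_powR g x : 0 < x -> {for x, continuous (fun y : R => y `^ g)}.
Proof. by move=> x0; exact: is_derive_continuous (is_derive1_powR g x0). Qed.

Lemma is_derive_powR_primitive g x X : -1 < g -> 0 < X -> 0 < x ->
  is_derive x 1 (fun y => X / (g + 1) * (y / X) `^ (g + 1)) ((x / X) `^ g).
Proof.
move=> g1 X0 x0; have xX : 0 < x / X by rewrite divr_gt0.
have g0 : 0 < g + 1 by lra.
have i1 : is_derive x 1 (fun y : R => y / X) X^-1.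
  by apply: is_derive_eq; rewrite -?[_ *: _]/(_ * _); ring.
have i2 := is_derive1_powR (g + 1) xX; rewrite addrK in i2.
have i3 : is_derive x 1 (fun y => (y / X) `^ (g + 1))
    ((g + 1) * (x / X) `^ g * X^-1).
  exact: (@is_derive1_comp R (fun y => y `^ (g + 1)) (fun y : R => y / X)).
apply: is_derive_eq; rewrite -?[_ *: _]/(_ * _).
by set q := _ `^ _; field; rewrite !gt_eqF.
Qed.

Lemma integral_powR_right g X : -1 < g -> 0 < X ->
  (\int[mu]_(x in `]0%R, X]) ((`|x| / X) `^ g)%:E <= (X / (g + 1))%:E)%E.
Proof.
move=> g1 X0; have g0 : 0 < g + 1 by lra.
(* The exhausting intervals [[X / (n + 2), X]] must be nondegenerate already for [n = 0], hence the
   shift by 2. *)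
have e1 n : X / n.+2%:R < X by rewrite ltr_pdivrMr// ltr_pMr// ltr1n.
have -> : (\int[mu]_(x in `]0%R, X]) ((`|x| / X) `^ g)%:E =
    \int[mu]_(x in `]0%R, X]) ((x / X) `^ g)%:E)%E.
  apply: eq_integral => x; by rewrite inE /= in_itv /= => /andP[x0 _]; rewrite gtr0_norm.
apply: (@ge0_integral_primitive_le _ _ (fun n => X / n.+2%:R) (fun=> X)
  (fun x => (x / X) `^ g) (fun y => X / (g + 1) * (y / X) `^ (g + 1))) => //.
- by move=> n m nm /=; rewrite ler_pM2l// lef_pV2 ?posrE// ler_nat.
- apply/seteqP; split => x /=.
    rewrite in_itv /= => /andP[x0 xX].
    exists (Num.trunc (X / x)) => //=; rewrite in_itv /= xX andbT.
    rewrite ler_pdivrMr// -ler_pdivrMl// mulrC.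
    apply: le_trans (ltW (truncnS_gt _)) _; by rewrite ler_nat.
  move=> [n _]; rewrite /= !in_itv /= => /andP[nx ->]; rewrite andbT.
  by apply: lt_le_trans nx; rewrite divr_gt0.
- by move=> x /=; rewrite in_itv /= => /andP[x0 _]; exact: is_derive_powR_primitive.
- move=> x /=; rewrite in_itv /= => /andP[x0 _].
  have i1 : is_derive x 1 (fun y : R => y / X) X^-1.
    by apply: is_derive_eq; rewrite -?[_ *: _]/(_ * _); ring.
  apply: (@continuous_comp _ _ _ (fun y => y / X) (fun y => y `^ g)).
    exact: is_derive_continuous i1.
  by apply: continuous_powR; rewrite divr_gt0.
- by move=> x _; exact: powR_ge0.
- move=> x y /=; rewrite !in_itv /= => /andP[x0 xX] /andP[y0 yX].
  have c0 : 0 <= X / (g + 1) by rewrite divr_ge0 ?(ltW X0) ?(ltW g0).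
  have : (y / X) `^ (g + 1) <= 1.
    rewrite -[leRHS](one_powR (g + 1)) ge0_ler_powR ?nnegrE ?(ltW g0)//.
      by rewrite divr_ge0// ltW.
    by rewrite ler_pdivrMr// mul1r.
  move=> /(ler_wpM2l c0); have := mulr_ge0 c0 (powR_ge0 (x / X) (g + 1)); lra.
Qed.

Lemma integral_powR_left g X : -1 < g -> 0 < X ->
  (\int[mu]_(x in `[(- X)%R, 0%R[) ((`|x| / X) `^ g)%:E <= (X / (g + 1))%:E)%E.
Proof.
move=> g1 X0; have g0 : 0 < g + 1 by lra.
have e1 n : X / n.+2%:R < X by rewrite ltr_pdivrMr// ltr_pMr// ltr1n.
have -> : (\int[mu]_(x in `[(- X)%R, 0%R[) ((`|x| / X) `^ g)%:E =
    \int[mu]_(x in `[(- X)%R, 0%R[) ((- x / X) `^ g)%:E)%E.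
  apply: eq_integral => x; by rewrite inE /= in_itv /= => /andP[_ x0]; rewrite ltr0_norm.
apply: (@ge0_integral_primitive_le _ _ (fun=> - X) (fun n => - (X / n.+2%:R))
  (fun x => (- x / X) `^ g) (fun y => - (X / (g + 1) * (- y / X) `^ (g + 1)))) => //.
- by move=> n m nm /=; rewrite lerN2 ler_pM2l// lef_pV2 ?posrE// ler_nat.
- by move=> n; rewrite ltrN2.
- apply/seteqP; split => x /=.
    rewrite in_itv /= => /andP[xX x0].
    have nx : 0 < - x by rewrite oppr_gt0.
    exists (Num.trunc (X / (- x))) => //=; rewrite in_itv /= xX /= lerNr.
    rewrite ler_pdivrMr// -ler_pdivrMl// mulrC.
    apply: le_trans (ltW (truncnS_gt _)) _; by rewrite ler_nat.
  move=> [n _]; rewrite /= !in_itv /= => /andP[-> nx] /=.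
  by apply: le_lt_trans nx _; rewrite oppr_lt0 divr_gt0.
- move=> x /=; rewrite in_itv /= => /andP[_ x0].
  have nx : 0 < - x by rewrite oppr_gt0.
  rewrite -[X in is_derive _ _ _ X]opprK; apply: is_deriveN.
  exact: (is_derive_reflect (is_derive_powR_primitive g1 X0 nx)).
- move=> x /=; rewrite in_itv /= => /andP[_ x0].
  have i1 : is_derive x 1 (fun y : R => - y / X) (- X^-1).
    by apply: is_derive_eq; rewrite -?[_ *: _]/(_ * _); ring.
  apply: (@continuous_comp _ _ _ (fun y => - y / X) (fun y => y `^ g)).
    exact: is_derive_continuous i1.
  by apply: continuous_powR; rewrite divr_gt0// oppr_gt0.
- by move=> x _; exact: powR_ge0.
- move=> x y /=; rewrite !in_itv /= => /andP[xX x0] /andP[yX y0].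
  have c0 : 0 <= X / (g + 1) by rewrite divr_ge0 ?(ltW X0) ?(ltW g0).
  have : (- x / X) `^ (g + 1) <= 1.
    rewrite -[leRHS](one_powR (g + 1)) ge0_ler_powR ?nnegrE ?(ltW g0)//.
      by rewrite divr_ge0 ?oppr_ge0 ?ltW.
    by rewrite ler_pdivrMr// mul1r lerNl.
  move=> /(ler_wpM2l c0); have := mulr_ge0 c0 (powR_ge0 (- y / X) (g + 1)); lra.
Qed.

(** With [q = |y| / |x|], the case [0 <= b] needs the upper bound
    [V y <= kappa ^ 2 * q ^ kappa^-1 * V x], and [b < 0] the lower bound
    [V y >= kappa ^ - 2 * q ^ kappa * V x]. The resulting exponent of [q] is [a + kappa^-1 * b] or
    [a + kappa * b], and each hypothesis makes one of them integrable at 0. *)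
Lemma power_weight_le a b : -1 < a + kappa^-1 * b -> -1 < a + kappa * b ->
  exists2 g, -1 < g & forall V, potential_class kappa V -> forall x y,
    y != 0 -> `|y| <= `|x| ->
    `|y| `^ a * V y `^ b <=
      (kappa ^+ 2) `^ `|b| * (`|y| / `|x|) `^ g * (`|x| `^ a * V x `^ b).
Proof.
move=> ab1 ab2; pose k := if 0 <= b then kappa^-1 else kappa.
exists (a + k * b); first by rewrite /k; case: ifP.
move=> V cV x y y0 yx.
have ny : 0 < `|y| by rewrite normr_gt0.
have nx : 0 < `|x| by exact: lt_le_trans yx.
have x0 : x != 0 by rewrite -normr_gt0.
set q := `|y| / `|x|; have q0 : 0 < q by rewrite divr_gt0.
have Vx0 := potential_gt0 cV x0; have Vy0 := potential_gt0 cV y0.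
have k20 : 0 < kappa ^+ 2 by rewrite exprn_gt0.
have [lo up] := potential_norm_le_decay kappa_ge1 cV y0 yx; rewrite -/q in lo up.
have [VxN VNx] := potential_norm_le kappa_ge1 x cV.
have Vb : V y `^ b <= (kappa ^+ 2) `^ `|b| * (q `^ k) `^ b * V x `^ b.
  rewrite /k; case: ifP => [b0|/negbT]; rewrite -?ltNge.
    rewrite (ger0_norm b0).
    have qk := powR_gt0 kappa^-1 q0.
    have Vy : V y <= kappa ^+ 2 * q `^ kappa^-1 * V x.
      apply: le_trans up _.
      have : kappa * q `^ kappa^-1 * V `|x| <= kappa * q `^ kappa^-1 * (kappa * V x).
        by rewrite ler_pM2l// mulr_gt0.
      by lra.
    have c0 : 0 <= kappa ^+ 2 * q `^ kappa^-1 by rewrite mulr_ge0 ?ltW.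
    rewrite -(powRM b (ltW k20) (ltW qk)) -(powRM b c0 (ltW Vx0)).
    by rewrite ge0_ler_powR ?nnegrE ?(ltW Vy0)// mulr_ge0// ltW.
  move=> b0; rewrite (ltr0_norm b0).
  have qk := powR_gt0 kappa q0.
  have Vy : kappa ^- 2 * q `^ kappa * V x <= V y.
    apply: le_trans lo.
    have c0 : 0 < kappa ^- 2 * q `^ kappa by rewrite mulr_gt0 ?invr_gt0.
    have := VxN; rewrite -(ler_pM2l c0) => /le_trans; apply.
    by rewrite le_eqVlt; apply/orP; left; apply/eqP; field; rewrite gt_eqF.
  have k2V : 0 < kappa ^- 2 by rewrite invr_gt0.
  have c0 : 0 < kappa ^- 2 * q `^ kappa by rewrite mulr_gt0.
  have -> : (kappa ^+ 2) `^ (- b) = (kappa ^- 2) `^ b by rewrite powRN powR_inv.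
  rewrite -(powRM b (ltW k2V) (ltW qk)) -(powRM b (ltW c0) (ltW Vx0)).
  rewrite -[b]opprK !(powRN _ (- b)) lef_pV2 ?posrE ?powR_gt0 ?mulr_gt0//.
  by rewrite ge0_ler_powR ?nnegrE ?(ltW Vy0) ?oppr_ge0 ?(ltW b0)// mulr_ge0// ltW.
have -> : `|y| `^ a = q `^ a * `|x| `^ a.
  by rewrite -powRM ?(ltW nx) ?(ltW q0)// /q divfK// gt_eqF.
rewrite powRD ?(gt_eqF q0) ?implybT// powRrM.
have c0 : 0 <= q `^ a * `|x| `^ a by rewrite mulr_ge0 ?powR_ge0.
by have := ler_wpM2l c0 Vb; lra.
Qed.

Lemma power_weight_bound a b : -1 < a + kappa^-1 * b -> -1 < a + kappa * b ->
  exists2 C : R, 0 < C & forall V, potential_class kappa V ->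
    forall W, (forall x, x != 0 -> W x = `|x| `^ a * V x `^ b) ->
    weight_bound V W a b C.
Proof.
move=> ab1 ab2; have [g g1 wle] := power_weight_le ab1 ab2.
have g0 : 0 < g + 1 by lra.
have k20 : 0 < kappa ^+ 2 by rewrite exprn_gt0.
pose K := (kappa ^+ 2) `^ `|b|; have K0 : 0 < K by rewrite powR_gt0.
(* The 1 serves the pointwise bound; each half of the interval contributes [K / (g + 1)] to the
   integral. *)
pose C := 1 + 2 * K / (g + 1).
have C1 : 1 <= C by rewrite lerDl divr_ge0 ?mulr_ge0 ?(ltW K0) ?(ltW g0).
exists C; first exact: lt_le_trans C1.
move=> V cV W WE x x0.
have nx : 0 < `|x| by rewrite normr_gt0.
set T := `|x| `^ a * V x `^ b.
have T0 : 0 <= T by rewrite mulr_ge0 ?powR_ge0.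
split; first by rewrite WE// -mulrA -/T ler_peMl.
set X := `|x| in nx *.
pose J := `[(- X)%R, X]%classic : set R.
pose Jl := `[(- X)%R, 0%R[%classic : set R; pose Jr := `]0%R, X]%classic : set R.
have mf (D : set R) : measurable_fun D (fun y => `|y| `^ a * V y `^ b).
  apply: measurable_funTS; apply: measurable_funM.
    apply: (measurableT_comp (f := fun z : R => z `^ a) (g := fun y : R => `|y|)).
      exact: measurable_powR.
    exact: normr_measurable.
  apply: (measurableT_comp (f := fun z : R => z `^ b) (g := V)).
    exact: measurable_powR.
  by apply: continuous_measurable_fun; exact: (potential_continuous kappa_ge1 cV).
have mW (D : set R) : (forall y, D y -> y != 0) -> measurable_fun D (fun y => (W y)%:E).
  move=> D0; apply/measurable_EFinP; apply: eq_measurable_fun (mf D) => y.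
  by rewrite inE => /D0 /WE.
(* The weight is prescribed only away from 0; deleting that point does not change the integral and
   separates the two half-intervals on which the power is integrated. *)
have JE : J `\ 0 = Jl `|` Jr.
  apply/seteqP; split => y; rewrite /J /Jl /Jr /= !in_itv /=.
    move=> [/andP[Xy yX] /eqP]; rewrite neq_lt => /orP[y0|y0]; [left|right];
      by rewrite ?Xy ?y0 ?yX.
  by move=> [/andP[Xy y0]|/andP[y0 yX]]; split; [lra|move=> yE; lra|lra|move=> yE; lra].
have J0 y : (Jl `|` Jr) y -> y != 0 by rewrite -JE => -[_ /eqP].
have JX y : (Jl `|` Jr) y -> `|y| <= X.
  by rewrite -JE => -[+ _]; rewrite /J /= in_itv /= -ler_norml.
have mJl : measurable Jl by exact: measurable_itv.
have mJr : measurable Jr by exact: measurable_itv.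
have W0 y : (Jl `|` Jr) y -> (0 <= (W y)%:E)%E.
  by move=> /J0 y0; rewrite WE// lee_fin mulr_ge0 ?powR_ge0.
rewrite -/J -(integral_setD1 (r := 0)); last 2 first.
- by rewrite JE; exact: measurableU.
- by rewrite JE; exact: mW.
rewrite JE ge0_integral_setU//; last 2 first.
- exact: mW.
- apply/disj_setPS => y []; rewrite /Jl /Jr /= !in_itv /=.
  by move=> /andP[_ y0] /andP[y0' _]; have := lt_trans y0 y0'; rewrite ltxx.
have part (D : set R) : measurable D -> D `<=` Jl `|` Jr ->
    (\int[mu]_(y in D) ((`|y| / X) `^ g)%:E <= (X / (g + 1))%:E)%E ->
    (\int[mu]_(y in D) (W y)%:E <= (K * T * (X / (g + 1)))%:E)%E.
  move=> mD DJ ID.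
  have mq : measurable_fun D (fun y => ((`|y| / X) `^ g)%:E).
    apply/measurable_EFinP; apply: measurable_funTS.
    apply: (measurableT_comp (f := fun z : R => z `^ g) (g := fun y : R => `|y| / X)).
      exact: measurable_powR.
    by apply: measurable_funM => //; exact: normr_measurable.
  have KT0 : 0 <= K * T by rewrite mulr_ge0 ?powR_ge0.
  apply: (@le_trans _ _ (\int[mu]_(y in D) ((K * T)%:E * ((`|y| / X) `^ g)%:E))%E).
    apply: ge0_le_integral => //.
    - by move=> y /DJ /W0.
    - by apply: mW => y /DJ /J0.
    - exact: measurable_funeM.
    - move=> y /DJ Jy; rewrite -EFinM lee_fin (WE _ (J0 _ Jy)).
      by have := wle V cV x y (J0 _ Jy) (JX _ Jy); rewrite -/K -/T -/X; lra.
  rewrite ge0_integralZl_EFin//; last by move=> y _; rewrite lee_fin powR_ge0.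
  by rewrite [X in (_ <= X)%E]EFinM; apply: lee_wpmul2l => //; rewrite lee_fin.
have Il := part _ mJl (@subsetUl _ _ _) (integral_powR_left g1 nx).
have Ir := part _ mJr (@subsetUr _ _ _) (integral_powR_right g1 nx).
apply: le_trans (leeD Il Ir) _.
rewrite -EFinD lee_fin powRD ?(gt_eqF nx) ?implybT// powRr1 ?(ltW nx)//.
have -> : C * (X `^ a * X) * V x `^ b = C * (T * X) by rewrite /T; ring.
have -> : K * T * (X / (g + 1)) + K * T * (X / (g + 1)) = (2 * K / (g + 1)) * (T * X).
  by ring.
have TX0 : 0 <= T * X by apply: mulr_ge0 => //; exact: ltW.
by apply: ler_wpM2r => //; rewrite /C lerDr.
Qed.

End PowerWeights.

(* In the third part, -1 < a + kappa * b follows from -1 < a + kappa^-1 * b when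
   0 <= b. For b < 0 it cannot be omitted: with V x = x ^+ 2, kappa = 2, a = 0
   and b = -1, the weight x ^- 2 is not integrable at 0. *)
Theorem theorem7p7 (R : realType) (kappa : R) (kappa_ge1 : 1 <= kappa) :
  [/\ (exists c K : R, [/\ 0 < c, 0 < K &
         forall V : R -> R, potential_class kappa V ->
         forall (n : nat) (E : R) (psi : R -> R),
           nth_eigenvalue V n E -> normalised_eigenfunction V E psi ->
         forall x : R, 4 * E <= V x ->
           eigenfunction_density psi E x <=
             K * ((sublevel_length V E)^-1
                  * expR (- (c * `|x| * Num.sqrt (V x))))]),
      (forall a b : R, exists2 K : R, 0 < K &
         forall V : R -> R, potential_class kappa V ->
         forall (W : R -> R) (C : R),
           measurable_fun [set: R] W -> (forall x, 0 <= W x) -> 0 < C ->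
           weight_bound V W a b C ->
         forall (n : nat) (E : R) (psi : R -> R),
           nth_eigenvalue V n E -> normalised_eigenfunction V E psi ->
           (\int[@lebesgue_measure R]_x
                (W x * eigenfunction_density psi E x)%:E
              <= (K * (C * sublevel_length V E `^ a * E `^ b))%:E)%E) &
      (forall a b : R, -1 < a + kappa^-1 * b -> -1 < a + kappa * b ->
         exists2 C : R, 0 < C &
         forall V : R -> R, potential_class kappa V ->
         forall W : R -> R, (forall x, x != 0 -> W x = `|x| `^ a * V x `^ b) ->
           weight_bound V W a b C)].
Proof.
split.
- have [c [K [c0 K0 decay]]] := eigenfunction_decay kappa_ge1.
  exists c, K; split => // V cV n E psi _ npsi x Vx.
  have [P sol] := eigenfunction_normalised_solution kappa_ge1 cV npsi.
  exact: (decay V cV _ _ _ _ sol _ Vx).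
- move=> a b; have [K K0 int] := eigenfunction_weighted_integral kappa_ge1 a b.
  exists K => // V cV W C mW W0 C0 WB n E psi _ npsi.
  have [P sol] := eigenfunction_normalised_solution kappa_ge1 cV npsi.
  exact: (int V cV _ _ mW W0 C0 WB _ _ _ _ sol).
- by move=> a b ab1 ab2; exact: (power_weight_bound kappa_ge1 ab1 ab2).
Qed.
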